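(* Let $N$ be an oriented even-dimensional Riemannian manifold, $M^2$ any Riemann surface, $I\subseteq\mathbb{R}$ an interval around $0$, and let $\psi:I\times M^2\to\Sigma^+N$ be a map $\mathcal{J}^1$-holomorphic to first order. Then the projected map $\varphi=\pi\circ\psi$ is real isotropic to first order.
   Context: All maps are smooth; $\varphi_t=\varphi(t,\cdot)$, $\psi_t=\psi(t,\cdot)$; $J$ is the complex structure of $M^2$ and $z$ a local complex coordinate. $\partial_z\varphi_t=\mathrm{d}\varphi_t(\partial_z)$ and $\partial_z^r\varphi_t=\nabla_{\partial_z}(\partial_z^{r-1}\varphi_t)$ (pull-back Levi-Civita connection); $\langle\cdot,\cdot\rangle$ is complex-bilinear. $\varphi$ is real isotropic to first order if $\langle\partial_z^r\varphi_0,\partial_z^s\varphi_0\rangle=0$ and $\frac{\partial}{\partial t}\big|_{t=0}\langle\partial_z^r\varphi_t,\partial_z^s\varphi_t\rangle=0$ for all $r,s\geq1$. Twistor space: $\pi:\Sigma^+N\to N$ is the bundle whose fibre at $x$ is the set of orthogonal $J':T_xN\to T_xN$ with $J'^2=-\mathrm{Id}$ that are positive (bases $\{e_1,J'e_1,\dots,e_n,J'e_n\}$ are positively oriented). The Levi-Civita connection on $\mathrm{End}(TN)\supseteq\Sigma^+N$ gives $T\Sigma^+N=\mathcal{H}\oplus\mathcal{V}$ with $\mathcal{V}=\ker\mathrm{d}\pi$, $\mathcal{V}_{(x,J')}=\{\lambda\in\mathfrak{so}(T_xN):\lambda J'=-J'\lambda\}$. $\mathcal{J}^1$ equals $(\mathrm{d}\pi|_{\mathcal{H}})^{-1}\circ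 J'\circ\mathrm{d}\pi|_{\mathcal{H}}$ on $\mathcal{H}_{(x,J')}$ and $\lambda\mapsto J'\circ\lambda$ on $\mathcal{V}_{(x,J')}$. $\Sigma^+N$ has the metric for which $\mathcal{H}\perp\mathcal{V}$, $\mathrm{d}\pi|_{\mathcal{H}}$ is isometric, and vertical vectors have the inner product $\sum_{i,j}\langle Ve_i,e_j\rangle\langle We_i,e_j\rangle$, $\{e_i\}$ orthonormal; $\nabla$ is its Levi-Civita connection. $\psi$ is $\mathcal{J}^1$-holomorphic to first order if $\psi_0$ is $(J,\mathcal{J}^1)$-holomorphic and $\nabla_{\partial_t|_{t=0}}\{\mathrm{d}\psi_t(JX)-\mathcal{J}^1\mathrm{d}\psi_tX\}=0$ for all $X\in TM$. *)

(* Defs.v *)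
From HB Require Import structures.
From mathcomp Require Import all_boot all_order all_algebra.
From mathcomp Require Import all_classical all_reals all_analysis.
From mathcomp Require Import complex lra.

Set Implicit Arguments.
Unset Strict Implicit.
Unset Printing Implicit Defensive.

Import Order.TTheory GRing.Theory Num.Theory.
Import numFieldNormedType.Exports.

Local Open Scope classical_set_scope.
Local Open Scope ring_scope.

(* Conventions.  Vectors are row vectors, so a linear operator acts on the    *)
(* right, [v |-> v *m A], and the composite "A after B" is [B *m A].          *)

Section Smooth.
Context {R : realType} {V W : normedModType R}.

Fixpoint iterD (vs : seq V) (f : V -> W) : V -> W :=
  if vs is v :: vs' then 'D_v (iterD vs' f) else f.

(* [A] is meant to be open: C^oo means that every iterated directional        *)
(* derivative is Frechet differentiable.                                      *)
Definition smooth_on (A : set V) (f : V -> W) :=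
  forall (vs : seq V) (x : V), A x -> differentiable (iterD vs f) x.

End Smooth.

Record chart (R : realType) (T : Type) (d : nat) := Chart {
  cdom : set T ;
  crd : T -> 'rV[R]_d ;
  cpt : 'rV[R]_d -> T (* inverse of [crd], on the image of [cdom] *)
}.

Definition cimg (R : realType) (T : Type) (d : nat) (c : chart R T d) :
  set 'rV[R]_d := crd c @` cdom c.

Definition is_chart (R : realType) (T : topologicalType) (d : nat)
    (c : chart R T d) :=
  [/\ open (cdom c), open (cimg c),
      forall x, cdom c x -> cpt c (crd c x) = x,
      forall x, cdom c x -> {for x, continuous (crd c)} &
      forall y, cimg c y -> {for y, continuous (cpt c)}].

(* The tangent space at [x] is R^d, identified with T_x through the preferred *)
(* chart [chart_at x].                                                        *)
Record manifold (R : realType) (d : nat) := Manifold {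
  mcarrier :> topologicalType ;
  atlas : set (chart R mcarrier d) ;
  chart_at : mcarrier -> chart R mcarrier d ;
  manifold_hausdorff : hausdorff_space mcarrier ;
  atlas_is_chart : forall c, atlas c -> is_chart c ;
  chart_at_atlas : forall x, atlas (chart_at x) ;
  chart_at_dom : forall x, cdom (chart_at x) x ;
  transition_smooth : forall c c', atlas c -> atlas c' ->
    smooth_on (crd c @` (cdom c `&` cdom c')) (crd c' \o cpt c)
}.

Definition oriented (R : realType) (d : nat) (N : manifold R d) :=
  forall (c c' : chart R N d) (x : N), atlas c -> atlas c' ->
    cdom c x -> cdom c' x ->
    0 < \det (jacobian (crd c' \o cpt c) (crd c x)).

(* Multiplication by i on C = R^2: (1, 0) |-> (0, 1) |-> (-1, 0). *)
Definition J0 (R : realType) : 'M[R]_2 := delta_mx 0 1 - delta_mx 1 0.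

(* The transition maps are holomorphic (Cauchy-Riemann equations). *)
Definition riemann_surface (R : realType) (M : manifold R 2) :=
  forall (c c' : chart R M 2) (x : M), atlas c -> atlas c' ->
    cdom c x -> cdom c' x ->
    let D := jacobian (crd c' \o cpt c) (crd c x) in
    J0 R *m D = D *m J0 R.

Section LeviCivita.
Context {R : realType} {d : nat}.
Implicit Types (G : 'rV[R]_d -> 'M[R]_d) (x v : 'rV[R]_d).

Definition pd_metric G x (l i j : 'I_d) : R :=
  'D_(delta_mx 0 l) (fun y => G y i j) x.

(* [christoffel G x k i j] is the symbol \Gamma^k_{ij} of the metric [G]. *)
Definition christoffel G x (k i j : 'I_d) : R :=
  2^-1 * \sum_l invmx (G x) k l *
    (pd_metric G x i j l + pd_metric G x j i l - pd_metric G x l i j).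

(* The operator \Gamma(v) : w |-> \Gamma^k_{ij} v^i w^j, so that              *)
(* \nabla_v w = dw(v) + w *m conn G x v.                                      *)
Definition conn G x v : 'M[R]_d :=
  \matrix_(j, k) \sum_i v 0 i * christoffel G x k i j.

(* [b] is the covariant derivative at time 0, along the curve [c], of the     *)
(* vector field [a] along [c], for the Levi-Civita connection of [G].         *)
Definition is_covderiv0 G (c a : R -> 'rV[R]_d) (b : 'rV[R]_d) :=
  exists c' a' : 'rV[R]_d,
    [/\ is_derive (0 : R) 1 c c', is_derive (0 : R) 1 a a' &
        b = a' + a 0 *m conn G (c 0) c'].

(* The two properties characterizing the Levi-Civita connection. *)
Lemma christoffel_torsion_free G x (k i j : 'I_d) :
  (forall y, (G y)^T = G y) -> christoffel G x k i j = christoffel G x k j i.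
Proof.
move=> Gsym; rewrite /christoffel; congr (_ * _); apply: eq_bigr => l _.
congr (_ * (_ - _)); first exact: addrC.
by rewrite /pd_metric; congr (derive _ x _); apply/funext => y;
   rewrite -{1}(Gsym y) mxE.
Qed.

Lemma christoffel_metric G x (l i j : 'I_d) :
  (forall y, (G y)^T = G y) -> G x \in unitmx ->
  pd_metric G x l i j =
    \sum_k (christoffel G x k l i * G x k j + christoffel G x k l j * G x i k).
Proof.
move=> Gsym Gu.
have pdC a b c : pd_metric G x a b c = pd_metric G x a c b.
  by rewrite /pd_metric; congr (derive _ x _); apply/funext => y;
     rewrite -{1}(Gsym y) mxE.
have low a b c : \sum_k christoffel G x k a b * G x k c =
    2^-1 * (pd_metric G x a b c + pd_metric G x b a c - pd_metric G x c a b).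
  pose w := \row_m (pd_metric G x a b m + pd_metric G x b a m
                    - pd_metric G x m a b).
  transitivity (2^-1 * (w *m (invmx (G x))^T *m G x) 0 c).
    rewrite mxE mulr_sumr; apply: eq_bigr => k _; rewrite mulrA; congr (_ * _).
    rewrite mxE; congr (_ * _); apply: eq_bigr => m _.
    by rewrite !mxE mulrC.
  by rewrite trmx_inv Gsym -mulmxA mulVmx // mulmx1 mxE.
rewrite big_split /= low.
under [X in _ + X]eq_bigr => k _.
  have -> : G x i k = G x k i by rewrite -{1}(Gsym x) mxE.
  over.
rewrite low (pdC l j i).
by move: (pd_metric G x) => p; lra.
Qed.

End LeviCivita.

Section Riemannian.
Context {R : realType} {d : nat} {N : manifold R d}.
Implicit Types (x : N) (u : chart R N d).

(* A tangent vector [v] at [x] has components [v *m frame_change x u] in [u]. *)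
Definition frame_change x u : 'M[R]_d :=
  jacobian (crd u \o cpt (chart_at x)) (crd (chart_at x) x).

(* The components in [u] of a bilinear form, resp. an endomorphism, on T_x. *)
Definition form_in x u (B : 'M[R]_d) : 'M[R]_d :=
  invmx (frame_change x u) *m B *m (invmx (frame_change x u))^T.

Definition endo_in x u (A : 'M[R]_d) : 'M[R]_d :=
  invmx (frame_change x u) *m A *m frame_change x u.

Definition metric_in (g : N -> 'M[R]_d) u (y : 'rV[R]_d) : 'M[R]_d :=
  form_in (cpt u y) u (g (cpt u y)).

Definition riemannian_metric (g : N -> 'M[R]_d) :=
  [/\ forall x, (g x)^T = g x,
      forall x (v : 'rV[R]_d), v != 0 -> 0 < (v *m g x *m v^T) 0 0 &
      forall u, atlas u -> smooth_on (cimg u) (metric_in g u)].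

End Riemannian.

Definition positive_cs (R : realType) (n : nat) (A : 'M[R]_(n.*2)) :=
  forall e : nat -> 'rV[R]_(n.*2),
    let B := \matrix_(i < n.*2) (if odd i then e i./2 *m A else e i./2) in
    \det B != 0 -> 0 < \det B.

(* A point of \Sigma^+N. *)
Record twistor (R : realType) (n : nat) (N : manifold R n.*2)
    (g : N -> 'M[R]_(n.*2)) := Twistor {
  tbase : N ;
  tcs : 'M[R]_(n.*2) ;
  tcs_orthogonal : tcs *m g tbase *m tcs^T = g tbase ;
  tcs_square : tcs *m tcs = - 1%:M ;
  tcs_positive : positive_cs tcs
}.

(* Geometry of End(TN) over a chart of N, in which a point is a pair (x, A)   *)
(* and a tangent vector a pair (x', A').  [G] is the metric of N in that      *)
(* chart.                                                                     *)
Section EndTN.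
Context {R : realType} {d : nat}.
Variable G : 'rV[R]_d -> 'M[R]_d.
Local Notation endo := ('rV[R]_d * 'M[R]_d)%type.
Implicit Types (a X Y : endo) (v : 'rV[R]_d) (L : 'M[R]_d).

(* Vertical component \nabla_{x'} A = A' + [A, \Gamma(x')]; the horizontal    *)
(* space is its kernel.                                                       *)
Definition vert a X : 'M[R]_d :=
  X.2 + a.2 *m conn G a.1 X.1 - conn G a.1 X.1 *m a.2.

Definition hlift a v : endo :=
  (v, conn G a.1 v *m a.2 - a.2 *m conn G a.1 v).

Lemma hlift_vert a X : hlift a X.1 + (0, vert a X) = X.
Proof.
case: X => v L; rewrite /hlift /vert /=; congr pair => /=; first exact: addr0.
by rewrite addrC addrA subrK addrK.
Qed.

Lemma vert_hlift a v : vert a (hlift a v) = 0.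
Proof. by rewrite /vert /hlift /= subrK subrr. Qed.

Definition acs1 a X : endo :=
  hlift a (X.1 *m a.2) + (0, vert a X *m a.2).

(* \sum_{i,j} <V e_i, e_j> <W e_i, e_j> for an orthonormal basis e; see       *)
(* [endo_inner_orthonormal].                                                  *)
Definition endo_inner (g V W : 'M[R]_d) : R :=
  \tr (V *m g *m W^T *m invmx g).

Lemma endo_inner_orthonormal (g V W E : 'M[R]_d) :
  g^T = g -> E *m g *m E^T = 1%:M ->
  endo_inner g V W =
    \sum_i \sum_j (row i E *m V *m g *m (row j E)^T) 0 0 *
                  (row i E *m W *m g *m (row j E)^T) 0 0.
Proof.
move=> gsym Eg.
have gEtE : g *m (E^T *m E) = 1%:M.
  by rewrite mulmxA; apply: mulmx1C; rewrite mulmxA.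
have [gu _] := mulmx1_unit gEtE.
have gV : invmx g = E^T *m E by rewrite -[RHS](mulKmx gu) gEtE mulmx1.
have rowE (L : 'M[R]_d) i j : (row i E *m L *m g *m (row j E)^T) 0 0 =
    (E *m L *m g *m E^T) i j.
  by rewrite -!row_mul !mxE; apply: eq_bigr => k _; rewrite !mxE.
transitivity (\tr ((E *m V *m g *m E^T) *m (E *m W *m g *m E^T)^T)).
  rewrite !trmx_mul trmxK gsym /endo_inner gV.
  rewrite -!mulmxA (mulmxA E^T E) (mulmxA (E^T *m E) g).
  by rewrite (mulmx1C gEtE) mul1mx [RHS]mxtrace_mulC -!mulmxA.
rewrite /mxtrace; apply: eq_bigr => i _; rewrite mxE; apply: eq_bigr => j _.
by rewrite !rowE [X in _ * X = _]mxE.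
Qed.

Definition twistor_inner a X Y : R :=
  (X.1 *m G a.1 *m Y.1^T) 0 0 + endo_inner (G a.1) (vert a X) (vert a Y).

End EndTN.

Section TwistorSpace.
Context {R : realType} {n : nat} {N : manifold R n.*2}.
Variable g : N -> 'M[R]_(n.*2).
Local Notation endo := ('rV[R]_(n.*2) * 'M[R]_(n.*2))%type.
Implicit Types (u : chart R N n.*2).

Definition endo_crd u (s : twistor g) : endo :=
  (crd u (tbase s), endo_in (tbase s) u (tcs s)).

(* Charts of \Sigma^+N as a submanifold of End(TN), over a chart [u] of N: a  *)
(* diffeomorphism [tpar] from an open subset of R^m onto a relatively open    *)
(* subset of \Sigma^+N; its inverse is the restriction of the smooth map      *)
(* [tinv], defined on an open subset [tamb] of End(TN).                       *)
Record twistor_chart (m : nat) := TwistorChart {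
  tdom : set 'rV[R]_m ;
  tpar : 'rV[R]_m -> twistor g ;
  tamb : set endo ;
  tinv : endo -> 'rV[R]_m
}.

Definition is_twistor_chart u m (k : twistor_chart m) :=
  [/\ open (tdom k) /\ open (tamb k),
      smooth_on (tdom k) (endo_crd u \o tpar k),
      smooth_on (tamb k) (tinv k),
      forall w, tdom k w ->
        [/\ cdom u (tbase (tpar k w)), tamb k (endo_crd u (tpar k w)) &
            tinv k (endo_crd u (tpar k w)) = w] &
      forall s : twistor g, cdom u (tbase s) -> tamb k (endo_crd u s) ->
        exists2 w, tdom k w & tpar k w = s].

(* The metric of \Sigma^+N in a chart. *)
Definition twistor_metric u m (k : twistor_chart m) (w : 'rV[R]_m) : 'M[R]_m :=
  let P := endo_crd u \o tpar k in
  \matrix_(i, j) twistor_inner (metric_in g u) (P w)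
    ('D_(delta_mx 0 i) P w) ('D_(delta_mx 0 j) P w).

(* For a vector field [V] along the curve [s] in \Sigma^+N, given through its *)
(* components in End(TN): the Levi-Civita covariant derivative of [V] at time *)
(* 0 vanishes, as computed in a chart of \Sigma^+N around [s 0].  There [a]   *)
(* gives the components of [V].                                               *)
Definition covderiv0_vanishes u (s : R -> twistor g) (V : R -> endo) :=
  exists (m : nat) (k : twistor_chart m) (a : R -> 'rV[R]_m),
    [/\ is_twistor_chart u k, tamb k (endo_crd u (s 0)),
        \forall t \near (0 : R),
          'D_(a t) (endo_crd u \o tpar k) (tinv k (endo_crd u (s t))) = V t &
        is_covderiv0 (twistor_metric u k)
          (fun t => tinv k (endo_crd u (s t))) a 0].

Section FirstOrder.
Context {M : manifold R 2}.
Variables (I : set R) (psi : R -> M -> twistor g).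
Implicit Types (p : M) (z : chart R M 2).

(* [I] need not be open, so smoothness means having local smooth extensions. *)
Definition smooth_variation :=
  forall t0 p z u, I t0 -> atlas z -> cdom z p ->
    atlas u -> cdom u (tbase (psi t0 p)) ->
  exists (O : set (R * 'rV[R]_2)) (F : R * 'rV[R]_2 -> endo),
    [/\ open O, O (t0, crd z p), smooth_on O F &
        forall t y, I t -> O (t, y) ->
          [/\ cimg z y, cdom u (tbase (psi t (cpt z y))) &
              endo_crd u (psi t (cpt z y)) = F (t, y)]].

(* d\psi_t(X), for X at [p] with components [v] in [z]. *)
Definition dpsi u z p (v : 'rV[R]_2) (t : R) : endo :=
  'D_v (fun y => endo_crd u (psi t (cpt z y))) (crd z p).

(* d\psi_t(JX) - J^1 d\psi_t(X) *)
Definition dbar u z p (v : 'rV[R]_2) (t : R) : endo :=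
  dpsi u z p (v *m J0 R) t -
  acs1 (metric_in g u) (endo_crd u (psi t p)) (dpsi u z p v t).

Definition holomorphic_first_order :=
  forall p z u (v : 'rV[R]_2), atlas z -> cdom z p ->
    atlas u -> cdom u (tbase (psi 0 p)) ->
    dbar u z p v 0 = 0 /\
    covderiv0_vanishes u (fun t => psi t p) (dbar u z p v).

End FirstOrder.
End TwistorSpace.

Section Isotropy.
Context {R : realType} {d : nat}.
Local Notation C := R[i].

Definition toC {m k : nat} (A : 'M[R]_(m, k)) : 'M[C]_(m, k) :=
  map_mx (real_complex R) A.

Definition connC (G : 'rV[R]_d -> 'M[R]_d) (x : 'rV[R]_d) (v : 'rV[C]_d) :
    'M[C]_d :=
  \matrix_(j, k) \sum_i v 0 i * (christoffel G x k i j)%:C%C.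

Definition pdC (e : 'rV[R]_2) (F : 'rV[R]_2 -> 'rV[C]_d) (y : 'rV[R]_2) :
    'rV[C]_d :=
  \row_k Complex ('D_e (fun y' => complex.Re (F y' 0 k)) y)
                 ('D_e (fun y' => complex.Im (F y' 0 k)) y).

Definition dz (F : 'rV[R]_2 -> 'rV[C]_d) (y : 'rV[R]_2) : 'rV[C]_d :=
  2^-1 *: (pdC (delta_mx 0 0) F y - (Complex 0 1) *: pdC (delta_mx 0 1) F y).

(* [zder G f r] represents \partial_z^{r+1} f. *)
Fixpoint zder (G : 'rV[R]_d -> 'M[R]_d) (f : 'rV[R]_2 -> 'rV[R]_d) (r : nat)
    (y : 'rV[R]_2) : 'rV[C]_d :=
  if r is r'.+1 then
    dz (zder G f r') y +
    zder G f r' y *m connC G (f y) (dz (fun y' => toC (f y')) y)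
  else dz (fun y' => toC (f y')) y.

Definition zpairing (G : 'rV[R]_d -> 'M[R]_d) (f : 'rV[R]_2 -> 'rV[R]_d)
    (r s : nat) (y : 'rV[R]_2) : C :=
  (zder G f r y *m toC (G (f y)) *m (zder G f s y)^T) 0 0.

Definition isotropic_first_order {N : manifold R d} {M : manifold R 2}
    (g : N -> 'M[R]_d) (phi : R -> M -> N) :=
  forall (p : M) (z : chart R M 2) (u : chart R N d) (r s : nat),
    atlas z -> cdom z p -> atlas u -> cdom u (phi 0 p) ->
    let h t := zpairing (metric_in g u)
      (fun y => crd u (phi t (cpt z y))) r s (crd z p) in
    [/\ h 0 = 0,
        is_derive (0 : R) 1 (fun t => complex.Re (h t)) 0 &
        is_derive (0 : R) 1 (fun t => complex.Im (h t)) 0].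

End Isotropy.

(* Main.v *)
Require Import Defs.
From mathcomp Require Import all_boot all_order all_algebra.
From mathcomp Require Import all_classical all_reals all_analysis.
From mathcomp Require Import complex ring lra.

Import Order.TTheory GRing.Theory Num.Theory.
Import numFieldNormedType.Exports.

Set Implicit Arguments.
Unset Strict Implicit.
Unset Printing Implicit Defensive.

Local Open Scope classical_set_scope.
Local Open Scope ring_scope.

(** Fix coordinates z on the surface and u on N, and write psi_t as a smooth
    map F = (x, A) of (t, y), where x is the base point and A the complex
    structure in the frame of u.  By the [twistor] axioms A *m A = -1 and
    A *m G *m A^T = G.  Say that a smooth function is flat when it vanishes
    together with its t-derivative at t = 0.  Flat functions form an ideal,
    and this ideal is stable under derivatives in y because t- and
    y-derivatives commute ([derive_schwarz], [flat_der]).  Everything below is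
    a computation modulo flat functions.

    - The hypothesis says that the dbar of F is flat: dbar vanishes at t = 0,
      so its covariant derivative there, for any connection, is the plain
      derivative of its components ([covderiv0_vanishes_derive]).
      Splitting dbar into a horizontal and a vertical part, x_1 - x_0 A and
      nabla_1 A - (nabla_0 A) A are flat ([dbar_pt], [dbar_cs]).

    - Let W_r be the (r+1)-st covariant z-derivative of x.  Were psi_t
      holomorphic, W_r would be of type (1,0), that is W_r A = i W_r: this
      holds for W_0, and it propagates because W_r nabla_z A = 0 when W_r is
      of type (1,0), nabla_0 A being anticommuting with A.  Keeping the error
      terms, [defect] r = W_r A - i W_r obeys an exact recursion ([defect0],
      [defectS]) in which every term contains the previous defect, its
      z-derivative or a part of dbar, so it is flat ([mxflat_defect]).

    - Vectors of type (1,0) are mutually isotropic, since A preserves G: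
      <W_r, W_s> = <W_r A, W_s A> = i i <W_r, W_s>.  With the error terms kept,
      twice the pairing is a sum of terms that each contain a defect, hence flat
      ([mxflat_pairing]).  Flatness of all the pairings is real isotropy to
      first order. *)

(** * Symmetry of second derivatives *)

Section Schwarz.
Context {R : realType} {V : normedModType R}.
Implicit Types (f : V -> R) (x u v : V).

Lemma diff_bound f x (e : R) : differentiable f x -> 0 < e ->
  exists2 d : R, 0 < d &
    forall w, `|w| < d -> `|f (w + x) - f x - 'd f x w| <= e * `|w|.
Proof.
move=> df e0.
have /eqaddoP /(_ e e0) := diff_locally df.
rewrite -nbhs_nearE => /nbhs_ballP[d /= d0 H]; exists d => // w wd.
have /H /= : ball 0 d w by rewrite -ball_normE/= sub0r normrN.
by rewrite !fctE /= opprD addrA.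
Qed.

Lemma is_derive_line f x v (s : R) : differentiable f (s *: v + x) ->
  is_derive s 1 (fun s' => f (s' *: v + x)) ('D_v f (s *: v + x)).
Proof.
move=> df; have dl : is_diff s (fun s' : R => s' *: v + x) ( *:%R ^~ v).
  by apply: is_diff_eq; rewrite addr0.
have := is_diff_comp dl (differentiableP df) => -[D E].
apply: DeriveDef; first exact: diff_derivable.
by rewrite deriveE // E /= scale1r deriveE.
Qed.

(** The mean value theorem in the direction u turns the second difference into
    a difference of two values of 'D_u f, each of which is given up to o(h) by
    the differential of 'D_u f at x.  The left-hand side is symmetric in u and
    v, which is why it computes both mixed derivatives. *)
Lemma second_difference f x u v (e : R) :
  (\forall y \near x, differentiable f y) -> differentiable ('D_u f) x ->
  0 < e ->
  exists2 d : R, 0 < d & forall h, 0 < h -> h < d ->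
    `|f (h *: u + (h *: v + x)) - f (h *: v + x) - f (h *: u + x) + f x
       - h ^+ 2 * 'D_v ('D_u f) x| <= e * h ^+ 2.
Proof.
move=> /nbhs_ballP[d1 /= d10 H1] dg e0.
(* h c bounds the distance from x of all the points where f is evaluated. *)
pose c := `|u| + `|v| + 1.
have c1 : 1 <= c by rewrite /c lerDr addr_ge0.
have c0 : 0 < c by apply: lt_le_trans c1.
have ec0 : 0 < e / (2 * c) by rewrite divr_gt0 // mulr_gt0.
have [d2 d20 H2] := diff_bound dg ec0.
exists (Num.min d1 d2 / c); first by rewrite divr_gt0 // lt_min d10.
move=> h h0; rewrite ltr_pdivlMr // lt_min => /andP[hd1 hd2].
have small (s : R) (b : bool) : 0 <= s -> s <= h ->
    `|s *: u + (if b then h *: v else 0)| <= h * c.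
  move=> s0 sh; apply: (le_trans (ler_normD _ _)).
  rewrite normrZ (ger0_norm s0).
  have -> : h * c = h * `|u| + h * `|v| + h by rewrite /c; ring.
  have : s * `|u| <= h * `|u| by rewrite ler_wpM2r.
  have : 0 <= h * `|v| by rewrite mulr_ge0 // ltW.
  by case: b; rewrite ?normrZ ?normr0 ?(gtr0_norm h0); lra.
have fd (s : R) (b : bool) : 0 <= s -> s <= h ->
    differentiable f (s *: u + ((if b then h *: v else 0) + x)).
  move=> s0 sh; apply: H1; rewrite -ball_normE /= distrC addrA addrK.
  exact: le_lt_trans (small _ _ s0 sh) hd1.
pose phi s := f (s *: u + (h *: v + x)) - f (s *: u + x).
pose dphi s := 'D_u f (s *: u + (h *: v + x)) - 'D_u f (s *: u + x).
have dphiP (s : R) : 0 <= s -> s <= h -> is_derive s 1 phi (dphi s).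
  move=> s0 sh; apply: is_deriveB; apply: is_derive_line.
    exact: (fd s true).
  by have := fd s false s0 sh; rewrite add0r.
have [||s] := @MVT R phi dphi 0 h h0.
- by move=> s; rewrite in_itv /= => /andP[s0 sh]; apply: dphiP; apply: ltW.
- apply: derivable_within_continuous => s; rewrite in_itv /= => /andP[s0 sh].
  by have [] := dphiP s s0 sh.
rewrite in_itv /= subr0 => /andP[/ltW s0 /ltW sh].
rewrite /phi scale0r !add0r => E.
have -> : f (h *: u + (h *: v + x)) - f (h *: v + x) - f (h *: u + x) + f x =
    dphi s * h by rewrite -E; ring.
have k1 := H2 _ (le_lt_trans (small s true s0 sh) hd2).
have k2 := H2 _ (le_lt_trans (small s false s0 sh) hd2).
have := small s true s0 sh; have := small s false s0 sh => /= s1 s2.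
rewrite /= addr0 in k1 k2 s1.
rewrite deriveE // /dphi addrA.
have dl : 'd ('D_u f) x (s *: u + h *: v) =
    'd ('D_u f) x (s *: u) + h * 'd ('D_u f) x v.
  by rewrite linearD; congr (_ + _); rewrite linearZ.
move: k1; rewrite dl.
move: ('D_u f (s *: u + h *: v + x)) ('D_u f (s *: u + x)) ('D_u f x) k2.
move: ('d ('D_u f) x (s *: u)) ('d ('D_u f) x v) => p q A B C k2 k1.
have -> : (A - B) * h - h ^+ 2 * q =
  h * ((A - C - (p + h * q)) - (B - C - p)) by ring.
rewrite normrM (gtr0_norm h0).
have -> : e * h ^+ 2 = h * (e / (2 * c) * (h * c) + e / (2 * c) * (h * c)).
  by field; rewrite gt_eqF.
rewrite ler_wpM2l ?(ltW h0)//; apply: (le_trans (ler_normB _ _)).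
  by apply: lerD; [apply: (le_trans k1)|apply: (le_trans k2)];
   rewrite ler_wpM2l // ltW.
Qed.

Lemma derive_schwarz f x u v :
  (\forall y \near x, differentiable f y) ->
  differentiable ('D_u f) x -> differentiable ('D_v f) x ->
  'D_v ('D_u f) x = 'D_u ('D_v f) x.
Proof.
move=> df du dv; apply/eqP; rewrite -subr_eq0 -normr_eq0 -[_ == 0]negbK.
set a := 'D_v _ x; set b := 'D_u _ x; apply/negP => ab.
have ab0 : 0 < `|a - b| by rewrite lt_neqAle eq_sym ab normr_ge0.
(* Two errors of size e h^2 cannot add up to |a - b| h^2. *)
pose e := `|a - b| / 4; have e0 : 0 < e by rewrite divr_gt0.
have [d1 d10 H1] := second_difference v df du e0.
have [d2 d20 H2] := second_difference u df dv e0.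
pose h := Num.min d1 d2 / 2.
have m0 : 0 < Num.min d1 d2 by rewrite lt_min d10.
have h0 : 0 < h by rewrite divr_gt0.
have hd1 : h < d1.
  by apply: (@lt_le_trans _ _ (Num.min d1 d2)); rewrite ?ge_min ?lexx // /h; lra.
have hd2 : h < d2.
  apply: (@lt_le_trans _ _ (Num.min d1 d2)); last by rewrite ge_min lexx orbT.
  by rewrite /h; lra.
have := H1 h h0 hd1; have := H2 h h0 hd2.
rewrite (addrCA (h *: v)) -/a -/b.
set A := f (h *: u + (h *: v + x)); move: A => A.
move: (f (h *: u + x)) (f (h *: v + x)) (f x) => B C D k2 k1.
have h20 : 0 < h ^+ 2 by rewrite exprn_gt0.
have : `|h ^+ 2 * (a - b)| <= e * h ^+ 2 + e * h ^+ 2.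
  apply: le_trans (lerD k2 k1); apply: le_trans (ler_normB _ _).
  by rewrite le_eqVlt; apply/orP; left; apply/eqP; congr `|_|; ring.
rewrite normrM (gtr0_norm h20) -mulrDl mulrC ler_pM2r // leNgt => /negP[].
have -> : e + e = `|a - b| / 2 by rewrite /e; field.
by rewrite ltr_pdivrMr // ltr_pMr // ltr1n.
Qed.

End Schwarz.

(** * Smooth functions *)

Section SmoothClosure.
Context {R : realType}.

(** [smooth_on] quantifies over lists of directions; unfolding one derivative
    at a time, with everything true at order 0, allows the closure properties
    to be proved by induction on the order. *)
Fixpoint Ck {V W : normedModType R} (k : nat) (O : set V) (f : V -> W) : Prop :=
  if k is k'.+1 then
    (forall x, O x -> differentiable f x) /\ forall v, Ck k' O ('D_v f)
  else True.

Lemma iterD_rcons {V W : normedModType R} (vs : seq V) v (f : V -> W) :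
  Defs.iterD (rcons vs v) f = Defs.iterD vs ('D_v f).
Proof. by elim: vs => //= w vs ->. Qed.

Lemma smooth_onP {V W : normedModType R} (O : set V) (f : V -> W) :
  smooth_on O f <-> forall k, Ck k O f.
Proof.
split=> [sf k|].
  elim: k f sf => //= k IH f sf; split=> [x|v]; first exact: (sf [::]).
  by apply: IH => vs x; rewrite -iterD_rcons; apply: sf.
move=> Cf vs; elim/last_ind: vs f Cf => [|vs v IH] f Cf x.
  by have [df _] := Cf 1%N; apply: df.
by rewrite iterD_rcons; apply: IH => k; have [_ +] := Cf k.+1; apply.
Qed.

Lemma differentiable_near_eq {V W : normedModType R} (f g : V -> W) x :
  (\forall y \near x, f y = g y) -> differentiable f x -> differentiable g x.
Proof.
move=> fg df.
have eg : g \o shift x = cst (g x) + 'd f x +o_ (0 : V) id.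
  apply/eqaddoP => e e0.
  have /eqaddoP /(_ e e0) := diff_locally df.
  apply: filter_app; move: fg; rewrite (near_shift 0 x) subr0 /= => fg.
  have gx : f x = g x by move/nbhs_singleton: (fg); rewrite /= add0r.
  move: fg; apply: filter_app; apply: nearW => y /= fgy.
  by rewrite !fctE /= -gx -fgy.
have dg : 'd g x = 'd f x :> (V -> W).
  by apply: diff_unique => //; exact: diff_continuous.
by apply/diff_locallyP; rewrite dg; split=> //; exact: diff_continuous.
Qed.

Lemma near_open_eq {V : normedModType R} {T} (O : set V) (f g : V -> T) x :
  open O -> (forall y, O y -> f y = g y) -> O x -> \forall y \near x, f y = g y.
Proof. by move=> oO fg Ox; apply: filterS fg _; apply: open_nbhs_nbhs. Qed.

Section Fixed.
Context {V : normedModType R} (O : set V).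
Hypothesis oO : open O.

Lemma Ck_eq {W : normedModType R} k (f g : V -> W) :
  (forall x, O x -> f x = g x) -> Ck k O f -> Ck k O g.
Proof.
elim: k f g => //= k IH f g fg [df Cf]; split=> [x Ox|v].
  by apply: differentiable_near_eq (df x Ox); apply: near_open_eq fg Ox.
apply: IH (Cf v) => x Ox; apply: near_eq_derive.
exact: near_open_eq fg Ox.
Qed.

Lemma CkS {W : normedModType R} k (f : V -> W) : Ck k.+1 O f -> Ck k O f.
Proof.
by elim: k f => //= k IH f [df Cf]; split=> // v; apply: IH.
Qed.

Lemma Ck_cst {W : normedModType R} k (c : W) : Ck k O (fun=> c).
Proof.
elim: k c => //= k IH c; split=> [x _|v]; first exact: differentiable_cst.
by apply: Ck_eq (IH 0) => x _; rewrite derive_cst.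
Qed.

Lemma CkD {W : normedModType R} k (f g : V -> W) :
  Ck k O f -> Ck k O g -> Ck k O (fun x => f x + g x).
Proof.
elim: k f g => //= k IH f g [df Cf] [dg Cg]; split=> [x Ox|v].
  by apply: differentiableD; [apply: df|apply: dg].
apply: Ck_eq (IH _ _ (Cf v) (Cg v)) => x Ox.
by rewrite -deriveD //; apply: diff_derivable; [apply: df|apply: dg].
Qed.

Lemma CkM k (f g : V -> R) :
  Ck k O f -> Ck k O g -> Ck k O (fun x => f x * g x).
Proof.
elim: k f g => //= k IH f g Cf Cg; have [df Df] := Cf; have [dg Dg] := Cg.
split=> [x Ox|v]; first by apply: differentiableM; [apply: df|apply: dg].
apply: Ck_eq (CkD (IH _ _ (CkS Cf) (Dg v)) (IH _ _ (CkS Cg) (Df v))) => x Ox.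
by rewrite -deriveM //; apply: diff_derivable; [apply: df|apply: dg].
Qed.

Lemma CkV k (f : V -> R) : (forall x, O x -> f x != 0) ->
  Ck k O f -> Ck k O (fun x => (f x)^-1).
Proof.
move=> f0; elim: k => //= k IH Cf; have [df Df] := Cf.
split=> [x Ox|v]; first by apply: differentiableV; [apply: df|apply: f0].
have C1 := IH (CkS Cf).
apply: Ck_eq (CkM (CkM (CkM (Ck_cst k (-1 : R)) C1) C1) (Df v)) => x Ox.
rewrite deriveV ?f0 //; last exact/diff_derivable/df.
by rewrite mulN1r mulNr -expr2 exprVn.
Qed.

Lemma Ck_sum k (I : Type) (r : seq I) (P : pred I) (F : I -> V -> R) :
  (forall i, Ck k O (F i)) -> Ck k O (fun x => \sum_(i <- r | P i) F i x).
Proof.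
move=> CF; elim: r => [|i r IH].
  by apply: Ck_eq (Ck_cst k 0) => x _; rewrite big_nil.
have [Pi|Pi] := boolP (P i).
  by apply: Ck_eq (CkD (CF i) IH) => x _; rewrite big_cons Pi.
by apply: Ck_eq IH => x _; rewrite big_cons (negbTE Pi).
Qed.

Lemma derive_linear {W W' : normedModType R} (L : {linear W -> W'})
    (f : V -> W) x v : continuous L -> differentiable f x ->
  'D_v (fun y => L (f y)) x = L ('D_v f x).
Proof.
move=> cL df; have dL := linear_differentiable (f x) cL.
rewrite [LHS]deriveE; last exact: differentiable_comp.
by rewrite [X in X v = _]diff_comp // diff_lin //= deriveE.
Qed.

Lemma Ck_linear {W W' : normedModType R} (L : {linear W -> W'}) k
  (f : V -> W) : continuous L -> Ck k O f -> Ck k O (fun y => L (f y)).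
Proof.
move=> cL; elim: k f => //= k IH f [df Cf]; split=> [x Ox|v].
  by apply: differentiable_comp; [apply: df|apply: linear_differentiable].
apply: Ck_eq (IH _ (Cf v)) => x Ox.
by rewrite derive_linear //; apply: df.
Qed.

End Fixed.

(** The chain rule in coordinates: it expresses a derivative of h o f as a
    sum of products of smooth functions and compositions, so that smoothness of
    compositions follows by induction. *)
Lemma derive_comp_row {V W : normedModType R} {d} (f : V -> 'rV[R]_d)
    (h : 'rV[R]_d -> W) x v : differentiable f x -> differentiable h (f x) ->
  'D_v (fun y => h (f y)) x =
    \sum_i ('D_v f x) 0 i *: 'D_(delta_mx 0 i) h (f x).
Proof.
move=> df dh; rewrite [LHS]deriveE; last exact: differentiable_comp.
rewrite [X in X v = _]diff_comp //= -['d f x v]deriveE //.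
rewrite {1}(row_sum_delta ('D_v f x)).
rewrite linear_sum; apply: eq_bigr => i _.
by rewrite linearZ -deriveE.
Qed.

End SmoothClosure.

Section SmoothAlgebra.
Context {R : realType} {V : normedModType R} (O : set V).
Hypothesis oO : open O.

Lemma smooth_diff {W : normedModType R} (f : V -> W) x :
  smooth_on O f -> O x -> differentiable f x.
Proof. by move=> sf; apply: (sf [::]). Qed.

Lemma smooth_derive {W : normedModType R} (f : V -> W) v :
  smooth_on O f -> smooth_on O ('D_v f).
Proof. by move=> sf vs x; rewrite -iterD_rcons; apply: sf. Qed.

Lemma smooth_eq {W : normedModType R} (f g : V -> W) :
  (forall x, O x -> f x = g x) -> smooth_on O f -> smooth_on O g.
Proof. by move=> fg /smooth_onP Cf; apply/smooth_onP => k; apply: Ck_eq fg _. Qed.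

Lemma smooth_cst {W : normedModType R} (c : W) : smooth_on O (fun=> c).
Proof. by apply/smooth_onP => k; apply: Ck_cst. Qed.

Lemma smoothD {W : normedModType R} (f g : V -> W) :
  smooth_on O f -> smooth_on O g -> smooth_on O (fun x => f x + g x).
Proof.
move=> /smooth_onP Cf /smooth_onP Cg; apply/smooth_onP => k.
exact: CkD.
Qed.

Lemma smoothM (f g : V -> R) :
  smooth_on O f -> smooth_on O g -> smooth_on O (fun x => f x * g x).
Proof.
move=> /smooth_onP Cf /smooth_onP Cg; apply/smooth_onP => k.
exact: CkM.
Qed.

Lemma smoothN (f : V -> R) : smooth_on O f -> smooth_on O (fun x => - f x).
Proof.
move=> sf; apply: smooth_eq (smoothM (smooth_cst (-1 : R)) sf) => x _.
by rewrite mulN1r.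
Qed.

Lemma smoothB (f g : V -> R) :
  smooth_on O f -> smooth_on O g -> smooth_on O (fun x => f x - g x).
Proof. by move=> sf sg; apply: smoothD sf (smoothN sg). Qed.

Lemma smoothV (f : V -> R) : (forall x, O x -> f x != 0) ->
  smooth_on O f -> smooth_on O (fun x => (f x)^-1).
Proof.
by move=> f0 /smooth_onP Cf; apply/smooth_onP => k; apply: CkV.
Qed.

Lemma smooth_sum (I : Type) (r : seq I) (P : pred I) (F : I -> V -> R) :
  (forall i, smooth_on O (F i)) ->
  smooth_on O (fun x => \sum_(i <- r | P i) F i x).
Proof.
move=> sF; apply/smooth_onP => k; apply: Ck_sum => // i.
by have /smooth_onP := sF i.
Qed.

Lemma smooth_prod (I : Type) (r : seq I) (F : I -> V -> R) :
  (forall i, smooth_on O (F i)) ->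
  smooth_on O (fun x => \prod_(i <- r) F i x).
Proof.
move=> sF; elim: r => [|i r IH].
  by apply: smooth_eq (smooth_cst (1 : R)) => x _; rewrite big_nil.
by apply: smooth_eq (smoothM (sF i) IH) => x _; rewrite big_cons.
Qed.

Lemma smooth_linear {W W' : normedModType R} (L : {linear W -> W'})
  (f : V -> W) : continuous L -> smooth_on O f -> smooth_on O (fun y => L (f y)).
Proof.
move=> cL /smooth_onP Cf; apply/smooth_onP => k.
exact: Ck_linear.
Qed.

Lemma smooth_entry {m n} (f : V -> 'M[R]_(m, n)) i j :
  smooth_on O f -> smooth_on O (fun x => f x i j).
Proof.
have @L : {linear 'M[R]_(m, n) -> R}.
  by exists (fun N : 'M[R]_(_, _) => N i j); do 2![eexists]; do ?[constructor];
     rewrite ?mxE// => ? *; rewrite ?mxE//; move=> ?; rewrite !mxE.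
by apply: (@smooth_linear _ _ L); exact: coord_continuous.
Qed.

Lemma smooth_comp {d} (U : set 'rV[R]_d) (f : V -> 'rV[R]_d)
    (h : 'rV[R]_d -> R) :
  (forall x, O x -> U (f x)) -> smooth_on O f -> smooth_on U h ->
  smooth_on O (fun x => h (f x)).
Proof.
move=> fU sf sh; apply/smooth_onP => k; elim: k h sh => //= k IH h sh.
have dh x : O x -> differentiable h (f x).
  by move=> /fU; apply: (sh [::]).
split=> [x Ox|v].
  by apply: differentiable_comp; [apply: smooth_diff sf Ox|apply: dh].
apply: (@Ck_eq _ _ _ oO _ _ (fun x => \sum_i ('D_v f x) 0 i *
    'D_(delta_mx 0 i) h (f x))) => [x Ox|].
  by rewrite derive_comp_row //; [apply: smooth_diff sf Ox|apply: dh].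
apply: Ck_sum => // i; apply: CkM => //; last first.
  by apply: (IH ('D_(delta_mx 0 i) h)) => vs x; rewrite -iterD_rcons; apply: sh.
have /smooth_onP : smooth_on O (fun x => 'D_v f x 0 i); last exact.
by apply: smooth_entry; apply: smooth_derive.
Qed.

Lemma smooth_det {n} (A : V -> 'M[R]_n) :
  (forall i j, smooth_on O (fun x => A x i j)) ->
  smooth_on O (fun x => \det (A x)).
Proof.
move=> sA; apply: smooth_sum => s; apply: smoothM; first exact: smooth_cst.
by apply: smooth_prod => i; apply: sA.
Qed.

Lemma smooth_invmx {n} (A : V -> 'M[R]_n) i j :
  (forall x, O x -> A x \in unitmx) ->
  (forall i j, smooth_on O (fun x => A x i j)) ->
  smooth_on O (fun x => invmx (A x) i j).
Proof.
move=> uA sA; have : smooth_on O (fun x => (\det (A x))^-1 * cofactor (A x) j i).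
  apply: smoothM; first apply: smoothV => [x Ox|].
  - by rewrite -unitfE -unitmxE uA.
  - exact: smooth_det.
  - apply: smoothM; first exact: smooth_cst.
    apply: smooth_det => k l; apply: smooth_eq (sA (lift j k) (lift i l)) => x _.
    by rewrite !mxE.
by apply: smooth_eq => x Ox; rewrite /invmx uA // !mxE.
Qed.

End SmoothAlgebra.

Lemma smooth_christoffel {R : realType} {d : nat} (U : set 'rV[R]_d)
    (G : 'rV[R]_d -> 'M[R]_d) k i j :
  open U -> (forall x, U x -> G x \in unitmx) -> smooth_on U G ->
  smooth_on U (fun x => christoffel G x k i j).
Proof.
move=> oU uG sG; have sGe a b : smooth_on U (fun x => G x a b).
  exact: smooth_entry.
have sp a b c : smooth_on U (fun x => pd_metric G x a b c).
  exact: smooth_derive.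
apply: smoothM => //; first exact: smooth_cst.
apply: smooth_sum => // l; apply: smoothM => //; first exact: smooth_invmx.
by apply: smoothB => //; apply: smoothD.
Qed.

(** * Smooth complex-valued matrices *)

Section Complex.
Context {R : realType} {V : normedModType R}.
Local Notation C := R[i].
Implicit Types (f g : V -> C) (m n p : nat).

Definition csmooth (O : set V) f :=
  smooth_on O (fun x => complex.Re (f x)) /\
  smooth_on O (fun x => complex.Im (f x)).

Definition cder (v : V) f (x : V) : C :=
  Complex ('D_v (fun y => complex.Re (f y)) x)
          ('D_v (fun y => complex.Im (f y)) x).

Definition mxsmooth (O : set V) {m n} (F : V -> 'M[C]_(m, n)) :=
  forall i j, csmooth O (fun x => F x i j).

Definition mxder (v : V) {m n} (F : V -> 'M[C]_(m, n)) (x : V) : 'M[C]_(m, n) :=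
  \matrix_(i, j) cder v (fun y => F y i j) x.

Lemma ReD (a b : C) : complex.Re (a + b) = complex.Re a + complex.Re b.
Proof. by case: a b => [? ?] []. Qed.
Lemma ImD (a b : C) : complex.Im (a + b) = complex.Im a + complex.Im b.
Proof. by case: a b => [? ?] []. Qed.
Lemma ReM (a b : C) :
  complex.Re (a * b) = complex.Re a * complex.Re b - complex.Im a * complex.Im b.
Proof. by case: a b => [? ?] []. Qed.
Lemma ImM (a b : C) :
  complex.Im (a * b) = complex.Re a * complex.Im b + complex.Im a * complex.Re b.
Proof. by case: a b => [? ?] []. Qed.
Definition complexE := (ReD, ImD, ReM, ImM).

Section Fixed.
Variable O : set V.
Hypothesis oO : open O.

Lemma csmooth_eq f g : (forall x, O x -> f x = g x) -> csmooth O f -> csmooth O g.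
Proof.
by move=> fg [s1 s2]; split; [apply: smooth_eq s1|apply: smooth_eq s2] => // x Ox;
   rewrite fg.
Qed.

Lemma csmooth_cst c : csmooth O (fun=> c).
Proof. by split; apply: smooth_cst. Qed.

Lemma csmooth_real (h : V -> R) : smooth_on O h -> csmooth O (fun x => (h x)%:C%C).
Proof. by move=> sh; split=> //=; apply: smooth_cst. Qed.

Lemma csmoothD f g : csmooth O f -> csmooth O g -> csmooth O (fun x => f x + g x).
Proof.
move=> [f1 f2] [g1 g2]; split.
  by apply: smooth_eq (smoothD oO f1 g1) => // x _; rewrite complexE.
by apply: smooth_eq (smoothD oO f2 g2) => // x _; rewrite complexE.
Qed.

Lemma csmoothM f g : csmooth O f -> csmooth O g -> csmooth O (fun x => f x * g x).
Proof.
move=> [f1 f2] [g1 g2]; split.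
  apply: smooth_eq (smoothB oO (smoothM oO f1 g1) (smoothM oO f2 g2)) => // x _.
  by rewrite complexE.
apply: smooth_eq (smoothD oO (smoothM oO f1 g2) (smoothM oO f2 g1)) => // x _.
by rewrite complexE.
Qed.

Lemma csmooth_sum (I : Type) (r : seq I) (F : I -> V -> C) :
  (forall i, csmooth O (F i)) -> csmooth O (fun x => \sum_(i <- r) F i x).
Proof.
move=> sF; elim: r => [|i r IH].
  by apply: csmooth_eq (csmooth_cst 0) => x _; rewrite big_nil.
by apply: csmooth_eq (csmoothD (sF i) IH) => x _; rewrite big_cons.
Qed.

Lemma csmooth_der v f : csmooth O f -> csmooth O (cder v f).
Proof. by move=> [f1 f2]; split; apply: smooth_derive. Qed.

Let dRe f v x : csmooth O f -> O x -> derivable (fun x => complex.Re (f x)) x v.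
Proof. by move=> [f1 _] Ox; apply/diff_derivable/(smooth_diff f1). Qed.
Let dIm f v x : csmooth O f -> O x -> derivable (fun x => complex.Im (f x)) x v.
Proof. by move=> [_ f2] Ox; apply/diff_derivable/(smooth_diff f2). Qed.

Lemma cderD v f g x : csmooth O f -> csmooth O g -> O x ->
  cder v (fun y => f y + g y) x = cder v f x + cder v g x.
Proof.
move=> sf sg Ox; rewrite /cder; congr Complex.
  rewrite -deriveD; [|exact: dRe|exact: dRe].
  by congr ('D_v _ x); apply/funext => y; rewrite complexE.
rewrite -deriveD; [|exact: dIm|exact: dIm].
by congr ('D_v _ x); apply/funext => y; rewrite complexE.
Qed.

Lemma cderM v f g x : csmooth O f -> csmooth O g -> O x ->
  cder v (fun y => f y * g y) x = cder v f x * g x + f x * cder v g x.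
Proof.
move=> sf sg Ox; rewrite /cder.
have -> : (fun y => complex.Re (f y * g y)) =
  ((fun y => complex.Re (f y)) * (fun y => complex.Re (g y))) -
  ((fun y => complex.Im (f y)) * (fun y => complex.Im (g y))).
  by apply/funext => y; rewrite complexE.
have -> : (fun y => complex.Im (f y * g y)) =
  ((fun y => complex.Re (f y)) * (fun y => complex.Im (g y))) +
  ((fun y => complex.Im (f y)) * (fun y => complex.Re (g y))).
  by apply/funext => y; rewrite complexE.
have fr := dRe (v := v) sf Ox; have fi := dIm (v := v) sf Ox.
have gr := dRe (v := v) sg Ox; have gi := dIm (v := v) sg Ox.
rewrite (deriveB (derivableM fr gr) (derivableM fi gi)).
rewrite (deriveD (derivableM fr gi) (derivableM fi gr)).
rewrite (deriveM fr gr) (deriveM fi gi) (deriveM fr gi) (deriveM fi gr).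
move: ('D_v _ x) ('D_v _ x) ('D_v _ x) ('D_v _ x) => f1 f2 g1 g2.
case: (f x) => a b; case: (g x) => c d /=.
congr Complex; rewrite /GRing.scale /=; ring.
Qed.

Lemma cder_cst v c x : cder v (fun=> c) x = 0.
Proof. by rewrite /cder !derive_cst. Qed.

Lemma cder_sum (I : Type) (r : seq I) (F : I -> V -> C) v x :
  (forall i, csmooth O (F i)) -> O x ->
  cder v (fun y => \sum_(i <- r) F i y) x = \sum_(i <- r) cder v (F i) x.
Proof.
move=> sF Ox; elim: r => [|i r IH].
  rewrite big_nil (_ : (fun y => _) = fun=> 0) ?cder_cst //.
  by apply/funext => y; rewrite big_nil.
rewrite big_cons -IH -cderD //; last exact: csmooth_sum.
by congr (cder v _ x); apply/funext => y; rewrite big_cons.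
Qed.

Lemma cder_near_eq v f g x : (\forall y \near x, f y = g y) ->
  cder v f x = cder v g x.
Proof.
move=> fg; rewrite /cder; congr Complex; apply: near_eq_derive;
  by apply: filterS fg => y ->.
Qed.

Lemma mxsmooth_eq m n (F H : V -> 'M[C]_(m, n)) :
  (forall x, O x -> F x = H x) -> mxsmooth O F -> mxsmooth O H.
Proof. by move=> FH sF i j; apply: csmooth_eq (sF i j) => x Ox; rewrite FH. Qed.

Lemma mxsmooth_cst m n (A : 'M[C]_(m, n)) : mxsmooth O (fun=> A).
Proof. by move=> i j; apply: csmooth_cst. Qed.

Lemma mxsmoothD m n (F H : V -> 'M[C]_(m, n)) :
  mxsmooth O F -> mxsmooth O H -> mxsmooth O (fun x => F x + H x).
Proof.
move=> sF sH i j; apply: csmooth_eq (csmoothD (sF i j) (sH i j)) => x _.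
by rewrite mxE.
Qed.

Lemma mxsmoothZ m n (a : C) (F : V -> 'M[C]_(m, n)) :
  mxsmooth O F -> mxsmooth O (fun x => a *: F x).
Proof.
move=> sF i j; apply: csmooth_eq (csmoothM (csmooth_cst a) (sF i j)) => x _.
by rewrite mxE.
Qed.

Lemma mxsmoothB m n (F H : V -> 'M[C]_(m, n)) :
  mxsmooth O F -> mxsmooth O H -> mxsmooth O (fun x => F x - H x).
Proof.
move=> sF /(mxsmoothZ (-1)) sH; apply: mxsmooth_eq (mxsmoothD sF sH) => x _.
by rewrite scaleN1r.
Qed.

Lemma mxsmoothM m n p (F : V -> 'M[C]_(m, n)) (H : V -> 'M[C]_(n, p)) :
  mxsmooth O F -> mxsmooth O H -> mxsmooth O (fun x => F x *m H x).
Proof.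
move=> sF sH i j.
apply: csmooth_eq (csmooth_sum _ (fun k => csmoothM (sF i k) (sH k j))) => x _.
by rewrite mxE.
Qed.

Lemma mxsmooth_tr m n (F : V -> 'M[C]_(m, n)) :
  mxsmooth O F -> mxsmooth O (fun x => (F x)^T).
Proof.
by move=> sF i j; apply: csmooth_eq (sF j i) => x _; rewrite mxE.
Qed.

Lemma mxsmooth_der v m n (F : V -> 'M[C]_(m, n)) :
  mxsmooth O F -> mxsmooth O (mxder v F).
Proof.
by move=> sF i j; apply: csmooth_eq (csmooth_der v (sF i j)) => x _; rewrite mxE.
Qed.

Lemma mxderD v m n (F H : V -> 'M[C]_(m, n)) x :
  mxsmooth O F -> mxsmooth O H -> O x ->
  mxder v (fun y => F y + H y) x = mxder v F x + mxder v H x.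
Proof.
move=> sF sH Ox; apply/matrixP => i j; rewrite !mxE -cderD //.
by congr (cder v _ x); apply/funext => y; rewrite mxE.
Qed.

Lemma mxderM v m n p (F : V -> 'M[C]_(m, n)) (H : V -> 'M[C]_(n, p)) x :
  mxsmooth O F -> mxsmooth O H -> O x ->
  mxder v (fun y => F y *m H y) x = mxder v F x *m H x + F x *m mxder v H x.
Proof.
move=> sF sH Ox; apply/matrixP => i j; rewrite !mxE -big_split /=.
transitivity (cder v (fun y => \sum_k F y i k * H y k j) x).
  by congr (cder v _ x); apply/funext => y; rewrite mxE.
rewrite cder_sum // => [|k]; last exact: csmoothM.
by apply: eq_bigr => k _; rewrite cderM // !mxE.
Qed.

Lemma mxder_cst v m n (A : 'M[C]_(m, n)) x : mxder v (fun=> A) x = 0.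
Proof. by apply/matrixP => i j; rewrite !mxE cder_cst. Qed.

Lemma mxderZ v m n (a : C) (F : V -> 'M[C]_(m, n)) x :
  mxsmooth O F -> O x -> mxder v (fun y => a *: F y) x = a *: mxder v F x.
Proof.
move=> sF Ox; transitivity (mxder v (fun y => a%:M *m F y) x).
  by congr (mxder v _ x); apply/funext => y; rewrite mul_scalar_mx.
rewrite mxderM //; last exact: mxsmooth_cst.
by rewrite mxder_cst mul0mx add0r mul_scalar_mx.
Qed.

End Fixed.
End Complex.

(** * The ideal of flat functions *)

Section Flat.
Context {R : realType} {V : normedModType R}.
Variables (O S : set V) (tau : V).
Hypothesis oO : open O.
Local Notation C := R[i].

(** Vanishing on S together with the derivative across S: in the application S
    is the slice t = 0 and [tau] is the direction of t. *)
Definition flat (f : V -> R) :=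
  smooth_on O f /\ forall x, O x -> S x -> f x = 0 /\ 'D_tau f x = 0.

Lemma flat_eq f g : (forall x, O x -> f x = g x) -> flat f -> flat g.
Proof.
move=> fg [sf f0]; split; first exact: smooth_eq fg sf.
move=> x Ox Sx; rewrite -fg // -(@near_eq_derive _ _ _ f); first exact: f0.
exact: near_open_eq fg Ox.
Qed.

Lemma flatD f g : flat f -> flat g -> flat (fun x => f x + g x).
Proof.
move=> [sf f0] [sg g0]; split; first exact: smoothD.
move=> x Ox Sx; have [-> df] := f0 x Ox Sx; have [-> dg] := g0 x Ox Sx.
rewrite addr0 deriveD ?df ?dg ?addr0 //; apply: diff_derivable.
  exact: smooth_diff sf Ox.
exact: smooth_diff sg Ox.
Qed.

Lemma flatM f g : flat f -> smooth_on O g -> flat (fun x => f x * g x).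
Proof.
move=> [sf f0] sg; split; first exact: smoothM.
move=> x Ox Sx; have [fx df] := f0 x Ox Sx; rewrite fx mul0r.
rewrite deriveM ?df ?fx ?scale0r ?scaler0 ?addr0 //; apply: diff_derivable.
  exact: smooth_diff sf Ox.
exact: smooth_diff sg Ox.
Qed.

Lemma derive_line_cst {W : normedModType R} (f : V -> W) x v c :
  (\forall h \near (0 : R), f (h *: v + x) = c) -> 'D_v f x = 0.
Proof.
move=> fc; apply/lim_near_cst => //=; apply: nbhs_dnbhs.
have fx : f x = c by have := nbhs_singleton fc; rewrite /= scale0r add0r.
by apply: filterS fc => h /= ->; rewrite fx subrr scaler0.
Qed.

(** On S both f and 'D_tau f are zero, and so are their derivatives in a
    direction v that preserves S; for 'D_tau ('D_v f) the order of the two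
    derivatives is exchanged first. *)
Lemma flat_der f v : (forall x (h : R), S x -> S (h *: v + x)) ->
  flat f -> flat ('D_v f).
Proof.
move=> Sv [sf f0]; split; first exact: smooth_derive.
have near_line x : O x -> \forall h \near (0 : R), O (h *: v + x).
  move=> Ox; have cl : {for (0 : R), continuous (fun h : R => h *: v + x)}.
    by apply: cvgD; [apply: cvgZr_tmp; apply: cvg_id|apply: cvg_cst].
  by apply: cl; rewrite scale0r add0r; apply: open_nbhs_nbhs.
move=> x Ox Sx; split.
  apply: (@derive_line_cst _ _ _ _ 0); apply: filterS (near_line x Ox) => h Oh.
  by have [] := f0 _ Oh (Sv _ h Sx).
rewrite derive_schwarz.
- apply: (@derive_line_cst _ _ _ _ 0); apply: filterS (near_line x Ox) => h Oh.
  by have [] := f0 _ Oh (Sv _ h Sx).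
- by apply: filterS (open_nbhs_nbhs (conj oO Ox)) => y; apply: smooth_diff.
- exact: smooth_diff (smooth_derive v sf) Ox.
- exact: smooth_diff (smooth_derive tau sf) Ox.
Qed.

Definition cflat (f : V -> C) :=
  flat (fun x => complex.Re (f x)) /\ flat (fun x => complex.Im (f x)).

Lemma cflat_smooth f : cflat f -> csmooth O f.
Proof. by move=> [[s1 _] [s2 _]]. Qed.

Lemma cflat_eq f g : (forall x, O x -> f x = g x) -> cflat f -> cflat g.
Proof.
by move=> fg [f1 f2]; split; [apply: flat_eq f1|apply: flat_eq f2] => x Ox;
   rewrite fg.
Qed.

Lemma cflatD f g : cflat f -> cflat g -> cflat (fun x => f x + g x).
Proof.
move=> [f1 f2] [g1 g2]; split.
  by apply: flat_eq (flatD f1 g1) => x _; rewrite complexE.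
by apply: flat_eq (flatD f2 g2) => x _; rewrite complexE.
Qed.

Lemma cflatM f g : cflat f -> csmooth O g -> cflat (fun x => f x * g x).
Proof.
move=> [f1 f2] [g1 g2].
have g2N : smooth_on O (fun x => - complex.Im (g x)) by apply: smoothN.
split.
  apply: flat_eq (flatD (flatM f1 g1) (flatM f2 g2N)) => x _.
  by rewrite complexE mulrN.
by apply: flat_eq (flatD (flatM f1 g2) (flatM f2 g1)) => x _; rewrite complexE.
Qed.

Lemma cflat0 : cflat (fun=> 0).
Proof.
have f0 : flat (fun=> 0).
  by split=> [|x _ _]; [apply: smooth_cst|rewrite derive_cst].
by split.
Qed.

Lemma cflat_sum (I : Type) (r : seq I) (F : I -> V -> C) :
  (forall i, cflat (F i)) -> cflat (fun x => \sum_(i <- r) F i x).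
Proof.
move=> sF; elim: r => [|i r IH].
  by apply: cflat_eq cflat0 => x _; rewrite big_nil.
by apply: cflat_eq (cflatD (sF i) IH) => x _; rewrite big_cons.
Qed.

Definition mxflat {m n} (F : V -> 'M[C]_(m, n)) :=
  forall i j, cflat (fun x => F x i j).

Section Matrices.
Context {m n : nat}.
Implicit Types (F H : V -> 'M[C]_(m, n)).

Lemma mxflat_smooth F : mxflat F -> mxsmooth O F.
Proof. by move=> fF i j; apply: cflat_smooth. Qed.

Lemma mxflat_eq F H : (forall x, O x -> F x = H x) -> mxflat F -> mxflat H.
Proof. by move=> FH fF i j; apply: cflat_eq (fF i j) => x Ox; rewrite FH. Qed.

Lemma mxflatD F H : mxflat F -> mxflat H -> mxflat (fun x => F x + H x).
Proof.
move=> fF fH i j; apply: cflat_eq (cflatD (fF i j) (fH i j)) => x _.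
by rewrite mxE.
Qed.

Lemma mxflatZ (a : C) F : mxflat F -> mxflat (fun x => a *: F x).
Proof.
move=> fF i j; apply: cflat_eq (cflatM (fF i j) (csmooth_cst oO a)) => x _.
by rewrite mxE mulrC.
Qed.

Lemma mxflatB F H : mxflat F -> mxflat H -> mxflat (fun x => F x - H x).
Proof.
move=> fF /(mxflatZ (-1)) fH; apply: mxflat_eq (mxflatD fF fH) => x _.
by rewrite scaleN1r.
Qed.

Lemma mxflat_tr F : mxflat F -> mxflat (fun x => (F x)^T).
Proof. by move=> fF i j; apply: cflat_eq (fF j i) => x _; rewrite mxE. Qed.

Lemma mxflat_der v F : (forall x (h : R), S x -> S (h *: v + x)) ->
  mxflat F -> mxflat (mxder v F).
Proof.
move=> Sv fF i j; have [f1 f2] := fF i j.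
apply: (@cflat_eq (cder v (fun y => F y i j))) => [x _|]; first by rewrite mxE.
by split; apply: flat_der.
Qed.

End Matrices.

Lemma mxflatMr {m n p} (F : V -> 'M[C]_(m, n)) (H : V -> 'M[C]_(n, p)) :
  mxflat F -> mxsmooth O H -> mxflat (fun x => F x *m H x).
Proof.
move=> fF sH i j.
apply: cflat_eq (cflat_sum _ (fun k => cflatM (fF i k) (sH k j))) => x _.
by rewrite mxE.
Qed.

Lemma mxflatMl {m n p} (F : V -> 'M[C]_(m, n)) (H : V -> 'M[C]_(n, p)) :
  mxsmooth O F -> mxflat H -> mxflat (fun x => F x *m H x).
Proof.
move=> sF fH i j.
apply: cflat_eq (cflat_sum _ (fun k => cflatM (fH k j) (sF i k))) => x _.
by rewrite mxE; apply: eq_bigr => k _; rewrite mulrC.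
Qed.

End Flat.

(** * Propagation of type (1,0) along covariant derivatives *)

Section MatrixIdentities.
Context {K : comNzRingType} {d : nat}.
Variables (i h : K).
Hypothesis ii : i * i = -1.
Implicit Types (v w W : 'rV[K]_d) (A N E c : 'M[K]_d).

Lemma defect0_alg v w A : A *m A = - 1%:M ->
  h *: (v - i *: w) *m A - i *: (h *: (v - i *: w)) =
  (- h) *: ((w - v *m A) + i *: ((w - v *m A) *m A)).
Proof.
move=> AA; rewrite mulmxBl -(mulmxA v) AA mulmxN mulmx1 opprK.
rewrite -scalemxAl mulmxBl -scalemxAl.
move: (v *m A) (w *m A) => vA wA; apply/rowP => k; rewrite !mxE; ring: ii.
Qed.

Lemma defectS_alg W A (zW : 'rV[K]_d) zA c :
  (zW + W *m c) *m A - i *: (zW + W *m c) =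
  (zW *m A + W *m zA - i *: zW) + (W *m A - i *: W) *m c -
  W *m (zA + A *m c - c *m A).
Proof.
rewrite mulmxBr mulmxBl !mulmxDl !mulmxDr !mulmxA -scalemxAl.
move: (W *m A *m c) (W *m c *m A) (zW *m A) (W *m zA) (W *m c) => *.
by apply/rowP => k; rewrite !mxE; ring.
Qed.

Lemma dz_defect_alg W A W0 W1 A0 A1 :
  h *: ((W0 *m A + W *m A0 - i *: W0) - i *: (W1 *m A + W *m A1 - i *: W1)) =
  h *: (W0 - i *: W1) *m A + W *m (h *: (A0 - i *: A1))
    - i *: (h *: (W0 - i *: W1)).
Proof.
rewrite -scalemxAr -scalemxAl mulmxBl mulmxBr -scalemxAl -scalemxAr.
move: (W0 *m A) (W1 *m A) (W *m A0) (W *m A1) => *.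
by apply/rowP => k; rewrite !mxE; ring.
Qed.

Lemma nab_dz_alg A A0 A1 c0 c1 :
  h *: (A0 - i *: A1) + A *m (h *: (c0 - i *: c1)) - h *: (c0 - i *: c1) *m A =
  h *: ((A0 + A *m c0 - c0 *m A) - i *: (A1 + A *m c1 - c1 *m A)).
Proof.
rewrite -scalemxAr -scalemxAl mulmxBl mulmxBr -scalemxAl -scalemxAr.
move: (A *m c0) (A *m c1) (c0 *m A) (c1 *m A) => *.
by apply/matrixP => j k; rewrite !mxE; ring.
Qed.

(** With N = nabla_0 A, E = [dbar_cs] and h = 1/2, the left-hand side is
    W nabla_z A.  It vanishes when W A = i W and E = 0, because
    W N A = - W A N. *)
Lemma mul_nab_dz_alg W A N E : N *m A = - (A *m N) ->
  W *m (h *: (N - i *: (N *m A + E))) =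
  (h * i) *: ((W *m A - i *: W) *m N - W *m E).
Proof.
move=> ->; rewrite -scalemxAr mulmxBr -scalemxAr mulmxDr mulmxN mulmxBl.
rewrite -scalemxAl !mulmxA; move: (W *m A *m N) (W *m N) (W *m E) => *.
by apply/rowP => k; rewrite !mxE; ring: ii.
Qed.

(** For p = v A and q = (w A)^T, the hypothesis says that A preserves the
    pairing B, and p - i v and q - i w measure the failure of v and w to be of
    type (1,0). *)
Lemma pairing_alg B (p v : 'rV[K]_d) (q w : 'cV[K]_d) : h + h = 1 ->
  p *m B *m q = v *m B *m w ->
  h *: (i *: ((p - i *: v) *m (B *m w)) + i *: (v *m B *m (q - i *: w)) +
        (p - i *: v) *m (B *m (q - i *: w))) = v *m B *m w.
Proof.
move=> hh pq; rewrite !mulmxBl !mulmxBr -!scalemxAl -!scalemxAr !mulmxA pq.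
move: (v *m B *m w) (v *m B *m q) (p *m B *m w) => r s t.
apply/matrixP => j k; rewrite !mxE -[RHS]mul1r -hh; ring: ii.
Qed.

End MatrixIdentities.

Section Isotropy.
Context {R : realType} {V : normedModType R} {d : nat}.
Local Notation C := R[i].
Local Notation I := (Complex 0 1 : C).
Variables (O S : set V) (tau e0 e1 : V).
Hypothesis oO : open O.
Hypothesis S0 : forall x (h : R), S x -> S (h *: e0 + x).
Hypothesis S1 : forall x (h : R), S x -> S (h *: e1 + x).

(** The operator d/dz = (d/dx_0 - i d/dx_1) / 2, for e0 and e1 the two
    coordinate directions of the surface. *)
Definition mdz {m n} (F : V -> 'M[C]_(m, n)) (q : V) : 'M[C]_(m, n) :=
  2^-1 *: (mxder e0 F q - I *: mxder e1 F q).

Lemma mxsmooth_dz {m n} (F : V -> 'M[C]_(m, n)) :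
  mxsmooth O F -> mxsmooth O (mdz F).
Proof.
move=> sF; apply: mxsmoothZ => //; apply: mxsmoothB => //.
  exact: mxsmooth_der.
by apply: mxsmoothZ => //; apply: mxsmooth_der.
Qed.

Lemma mxflat_dz {m n} (F : V -> 'M[C]_(m, n)) :
  mxflat O S tau F -> mxflat O S tau (mdz F).
Proof.
move=> fF; apply: mxflatZ => //; apply: mxflatB => //; first exact: mxflat_der.
by apply: mxflatZ => //; apply: mxflat_der.
Qed.

Lemma imM : I * I = -1.
Proof. by apply/eqP; rewrite eq_complex /= !mul0r !mul1r sub0r add0r oppr0 !eqxx. Qed.

Lemma connC_dz (G : 'rV[R]_d -> 'M[R]_d) x (a b : C) (v w : 'rV[C]_d) :
  connC G x (a *: (v - b *: w)) = a *: (connC G x v - b *: connC G x w).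
Proof.
apply/matrixP => j k; rewrite !mxE !mulr_sumr -sumrB mulr_sumr.
by apply: eq_bigr => i _; rewrite !mxE -mulrA mulrBl -mulrA.
Qed.

Variables (G : 'rV[R]_d -> 'M[R]_d) (x : V -> 'rV[R]_d).
Variables (A Gx : V -> 'M[C]_d).
Local Notation X := (fun q => toC (x q)).
Local Notation conn := (fun q => connC G (x q)).
Hypothesis sX : mxsmooth O X.
Hypothesis sA : mxsmooth O A.
Hypothesis sG : mxsmooth O Gx.
Hypothesis sconn : forall v, mxsmooth O v -> mxsmooth O (fun q => conn q (v q)).
Hypothesis AA : forall q, O q -> A q *m A q = - 1%:M.
Hypothesis AG : forall q, O q -> A q *m Gx q *m (A q)^T = Gx q.

(** The covariant derivative of A along e: A acts on row vectors from the
    right, hence the signs of the two connection terms. *)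
Definition nabA (e : V) (q : V) : 'M[C]_d :=
  mxder e A q + A q *m conn q (mxder e X q) - conn q (mxder e X q) *m A q.

(** The horizontal part of d psi (J e0) - J^1 d psi (e0), that is, the
    failure of the base point map to have differential commuting with the
    complex structures. *)
Definition dbar_pt q := mxder e1 X q - mxder e0 X q *m A q.

(** The vertical part of d psi (J e0) - J^1 d psi (e0), up to a term linear in
    [dbar_pt]: in [acs1] the horizontal lift is taken along x_0 A instead of
    x_1. *)
Definition dbar_cs q := nabA e1 q - nabA e0 q *m A q.
Hypothesis fdbar_pt : mxflat O S tau dbar_pt.
Hypothesis fdbar_cs : mxflat O S tau dbar_cs.

Fixpoint iter_dz (r : nat) : V -> 'rV[C]_d :=
  if r is r'.+1 then
    fun q => mdz (iter_dz r') q + iter_dz r' q *m conn q (mdz X q)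
  else mdz X.

Let sconnX : mxsmooth O (fun q => conn q (mdz X q)).
Proof. exact/sconn/mxsmooth_dz. Qed.

Lemma mxsmooth_iter_dz r : mxsmooth O (iter_dz r).
Proof.
elim: r => [|r IH] /=; first exact: mxsmooth_dz.
by apply: mxsmoothD => //; [apply: mxsmooth_dz|apply: mxsmoothM].
Qed.

Lemma mxsmooth_nabA e : mxsmooth O (nabA e).
Proof.
have sc : mxsmooth O (fun q => conn q (mxder e X q)).
  exact/sconn/mxsmooth_der.
apply: mxsmoothB => //; last exact: mxsmoothM.
by apply: mxsmoothD => //; [apply: mxsmooth_der|apply: mxsmoothM].
Qed.

(** The covariant derivative of A^2 = -1. *)
Lemma nabA_anticomm e q : O q -> nabA e q *m A q = - (A q *m nabA e q).
Proof.
move=> Oq; have : mxder e A q *m A q + A q *m mxder e A q = 0.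
  rewrite -(mxderM oO) //; apply/matrixP => i j; rewrite !mxE.
  rewrite (@cder_near_eq _ _ _ _ (fun=> (- 1%:M : 'M[C]_d) i j)) ?cder_cst //.
  by apply: near_open_eq Oq => // y Oy; rewrite AA.
rewrite /nabA; move: (mxder e A q) (conn q _) => dA c /eqP.
rewrite addr_eq0 => /eqP dAA.
rewrite mulmxBl mulmxDl mulmxBr mulmxDr dAA !mulmxA AA //.
rewrite -(mulmxA c) AA // mulmxN mulNmx mul1mx mulmx1.
by rewrite !opprD !opprK; move: (A q *m c *m A q) => B; rewrite addrAC -!addrA.
Qed.

Definition defect r q := iter_dz r q *m A q - I *: iter_dz r q.

Lemma defect0 q : O q -> defect 0 q =
  (- 2^-1) *: (dbar_pt q + I *: (dbar_pt q *m A q)).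
Proof. by move=> Oq; rewrite /defect /= /mdz /dbar_pt (defect0_alg _ imM) // AA. Qed.

(** Leibniz rule; the middle term is what the connection turns into
    W_r nabla_z A in [defectS]. *)
Lemma dz_defect r q : O q -> mdz (defect r) q =
  mdz (iter_dz r) q *m A q + iter_dz r q *m mdz A q - I *: mdz (iter_dz r) q.
Proof.
move=> Oq; have sW := mxsmooth_iter_dz r.
have der e : mxder e (defect r) q = mxder e (iter_dz r) q *m A q +
    iter_dz r q *m mxder e A q - I *: mxder e (iter_dz r) q.
  have sWA := mxsmoothM oO sW sA; have sIW := mxsmoothZ oO (- I) sW.
  rewrite -(mxderM oO) // -scaleNr -(mxderZ oO) // -(mxderD e sWA sIW Oq).
  by congr (mxder e _ q); apply/funext => y; rewrite scaleNr.
rewrite /mdz !der.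
exact: (dz_defect_alg I 2^-1 (iter_dz r q) (A q) (mxder e0 (iter_dz r) q)
  (mxder e1 (iter_dz r) q) (mxder e0 A q) (mxder e1 A q)).
Qed.

Lemma defectS r q : O q -> defect r.+1 q =
  mdz (defect r) q + defect r q *m conn q (mdz X q) -
  (2^-1 * I) *: (defect r q *m nabA e0 q - iter_dz r q *m dbar_cs q).
Proof.
move=> Oq; rewrite (dz_defect r Oq).
have -> : defect r.+1 q =
    (mdz (iter_dz r) q + iter_dz r q *m conn q (mdz X q)) *m A q
    - I *: (mdz (iter_dz r) q + iter_dz r q *m conn q (mdz X q)) by [].
rewrite (defectS_alg I (iter_dz r q) (A q) (mdz (iter_dz r) q) (mdz A q)).
congr (_ - _).
have := mul_nab_dz_alg 2^-1 imM (iter_dz r q) (dbar_cs q) (nabA_anticomm e0 Oq).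
rewrite -/(defect r q) => <-; congr (_ *m _).
have -> : nabA e0 q *m A q + dbar_cs q = nabA e1 q by rewrite addrC subrK.
rewrite /mdz connC_dz.
exact: (nab_dz_alg I 2^-1 (A q) (mxder e0 A q) (mxder e1 A q)
  (conn q (mxder e0 X q)) (conn q (mxder e1 X q))).
Qed.

Lemma mxflat_defect r : mxflat O S tau (defect r).
Proof.
elim: r => [|r IH].
  suff fl : mxflat O S tau (fun q =>
      (- 2^-1) *: (dbar_pt q + I *: (dbar_pt q *m A q))).
    by apply: mxflat_eq fl => // q Oq; rewrite defect0.
  exact/(mxflatZ oO)/(mxflatD oO fdbar_pt)/(mxflatZ oO)/(mxflatMr oO fdbar_pt sA).
have fl1 := mxflatD oO (mxflat_dz IH) (mxflatMr oO IH sconnX).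
have fl2 := mxflatB oO (mxflatMr oO IH (mxsmooth_nabA e0))
  (mxflatMl oO (mxsmooth_iter_dz r) fdbar_cs).
have fl := mxflatB oO fl1 (mxflatZ oO (2^-1 * I) fl2).
by apply: (mxflat_eq oO _ fl) => q Oq; apply: esym (defectS r Oq).
Qed.

Lemma mxflat_pairing r s :
  mxflat O S tau (fun q => iter_dz r q *m Gx q *m (iter_dz s q)^T).
Proof.
have sW k := mxsmooth_iter_dz k; have fD k := mxflat_defect k.
pose P1 q := defect r q *m (Gx q *m (iter_dz s q)^T).
pose P2 q := (iter_dz r q *m Gx q) *m (defect s q)^T.
pose P3 q := defect r q *m (Gx q *m (defect s q)^T).
have fP : mxflat O S tau (fun q => 2^-1 *: (I *: P1 q + I *: P2 q + P3 q)).
  have sGW := mxsmoothM oO sG (mxsmooth_tr oO (sW s)).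
  have sGD := mxsmoothM oO sG (mxsmooth_tr oO (mxflat_smooth (fD s))).
  have f1 := mxflatMr oO (fD r) sGW; have f3 := mxflatMr oO (fD r) sGD.
  have f2 := mxflatMl oO (mxsmoothM oO (sW r) sG) (mxflat_tr oO (fD s)).
  by have := mxflatD oO (mxflatD oO (mxflatZ oO I f1) (mxflatZ oO I f2)) f3;
    apply: mxflatZ.
apply: (mxflat_eq oO _ fP) => q Oq; rewrite /P1 /P2 /P3 /defect.
have -> : (iter_dz s q *m A q - I *: iter_dz s q)^T =
    (iter_dz s q *m A q)^T - I *: (iter_dz s q)^T.
  by apply/matrixP => i j; rewrite !mxE.
apply: (pairing_alg imM); last first.
  by rewrite trmx_mul !mulmxA -[in RHS](AG Oq) !mulmxA.
by rewrite -mulr2n -[LHS]mulr_natl mulfV // pnatr_eq0.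
Qed.

End Isotropy.

(** * The covariant derivative of a field vanishing at time 0 *)

Section ParallelAtZero.
Context {R : realType} {n : nat} {N : manifold R n.*2} {g : N -> 'M[R]_(n.*2)}.
Local Notation endo := ('rV[R]_(n.*2) * 'M[R]_(n.*2))%type.

Lemma is_derive_combination {W : normedModType R} {m : nat} (a : R -> 'rV[R]_m)
    (Q : 'I_m -> R -> W) :
  a 0 = 0 -> is_derive (0 : R) 1 a 0 ->
  (forall i, {for 0, continuous (Q i)}) ->
  is_derive (0 : R) 1 (fun t => \sum_i a t 0 i *: Q i t) 0.
Proof.
move=> a0 [da ea] cQ.
have ca i : h^-1 * a h 0 i @[h --> (0:R)^'] --> (0 : R).
  pose f t : R := a t 0 i.
  have df : h^-1 *: (f (h *: 1 + 0) - f 0) @[h --> (0:R)^'] --> 'D_1 f 0.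
    by have /derivable_mxP /(_ 0 i) := da.
  have f'0 : 'D_1 f 0 = 0.
    by have := derive_mx da; rewrite ea => /matrixP/(_ 0 i); rewrite !mxE.
  rewrite f'0 in df; apply: cvg_trans df; apply: near_eq_cvg.
  apply: nearW => h /=.
  by rewrite /f a0 mxE subr0 addr0 [_ *: 1]mulr1.
have cs : h^-1 *: (\sum_i a (h *: 1 + 0) 0 i *: Q i (h *: 1 + 0)
     - \sum_i a 0 0 i *: Q i 0) @[h --> (0:R)^'] --> (0 : W).
  have cS : \sum_(i < m) (h^-1 * a h 0 i) *: Q i h @[h --> (0:R)^'] -->
      \sum_(i < m) (0 : R) *: Q i 0.
    apply: cvg_big => [|i _]; first exact: add_continuous.
    apply: cvgZ; first exact: ca.
    by apply: cvg_trans (cQ i); apply: cvg_app; apply: cvg_within.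
  rewrite [X in _ --> X]big1 in cS => [|i _]; last by rewrite scale0r.
  apply: cvg_trans cS.
  apply: near_eq_cvg; apply: nearW => h /=.
  rewrite [X in _ - X]big1 => [|i _]; last by rewrite a0 mxE scale0r.
  rewrite subr0 addr0 [_ *: 1]mulr1 scaler_sumr.
  by apply: eq_bigr => i _; rewrite scalerA.
by split; [apply/cvg_ex; exists 0|apply: cvg_lim cs].
Qed.

(** Let a be the components of V in a chart of the twistor space.  Since
    V 0 = 0 and the parametrization is an immersion (it has a smooth left
    inverse), a 0 = 0; then the Christoffel term of the covariant derivative
    vanishes and the condition reads a' = 0.  As V is a combination of
    the coordinate fields with coefficients a, its derivative at 0 is 0. *)
Lemma covderiv0_vanishes_derive u (s : R -> twistor g) (V : R -> endo) :
  cdom u (tbase (s 0)) -> V 0 = 0 -> covderiv0_vanishes u s V ->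
  is_derive (0 : R) 1 V 0.
Proof.
move=> us V0 [m [k [a [[[oD oA] sP sI kP surj] s0 Va [w' [a' [dw da ba]]]]]]].
set P := endo_crd u \o tpar k in sP Va.
set w := fun t => tinv k (endo_crd u (s t)) in Va dw ba.
have [w0 Dw0 sw0] := surj _ us s0.
have wE : w 0 = w0 by rewrite /w -sw0; have [] := kP _ Dw0.
have dP : differentiable P w0 by apply: (sP [::]).
have a0 : a 0 = 0.
  have Va0 : 'D_(a 0) P w0 = 0 by have := nbhs_singleton Va; rewrite -wE /w V0.
  have dI : differentiable (tinv k) (P w0).
    by apply: (sI [::]); have [_ H _] := kP _ Dw0.
  have : 'D_(a 0) (tinv k \o P) w0 = a 0.
    rewrite (@near_eq_derive _ _ _ _ id) ?derive_id //.
    by apply: near_open_eq Dw0 => // y Dy /=; have [] := kP _ Dy.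
  rewrite deriveE; last exact: differentiable_comp.
  by rewrite diff_comp //= -['d P w0 _]deriveE // Va0 linear0.
have a'0 : a' = 0 by move: ba; rewrite a0 mul0mx addr0.
have cw : {for 0, continuous w}.
  apply: differentiable_continuous; apply/derivable1_diffP.
  by case: dw.
have Vsum : \forall t \near (0 : R),
    \sum_i a t 0 i *: 'D_(delta_mx 0 i) P (w t) = V t.
  have : \forall t \near (0 : R), tdom k (w t).
    by apply: cw; rewrite wE; apply: open_nbhs_nbhs.
  move: Va; apply: filterS2 => t Vt Dt; rewrite -Vt.
  have dPt : differentiable P (w t) by apply: (sP [::]).
  rewrite -/(w t) deriveE // [in RHS](row_sum_delta (a t)) linear_sum.
  by apply: eq_bigr => i _; rewrite linearZ -deriveE.
apply: near_eq_is_derive Vsum _.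
apply: (is_derive_combination a0); first by rewrite -a'0.
move=> i; apply: (@continuous_comp _ _ _ w ('D_(delta_mx 0 i) P)).
  exact: cw.
rewrite wE; apply: differentiable_continuous.
exact: (sP [:: delta_mx 0 i] w0 Dw0).
Qed.

End ParallelAtZero.

(** * Time and space derivatives of a map of (t, y) *)

Section Slices.
Context {R : realType} {U W : normedModType R}.

Lemma derive_slice (f : R * U -> W) t y v :
  'D_v (fun y' => f (t, y')) y = 'D_(0, v) f (t, y).
Proof.
rewrite /derive.
have -> // : (fun h : R => h^-1 *: (((fun y' => f (t, y')) \o shift y) (h *: v)
    - f (t, y))) =
  (fun h : R => h^-1 *: ((f \o shift (t, y)) (h *: (0, v)) - f (t, y))).
apply/funext => h /=; congr (_ *: (f _ - _)).
by rewrite [RHS](_ : _ = (h *: 0 + t, h *: v + y)) // scaler0 add0r.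
Qed.

Let quotient_time (f : R * U -> W) t y :
  (fun h : R => h^-1 *: (((fun t' => f (t', y)) \o shift t) (h *: 1) - f (t, y))) =
  (fun h : R => h^-1 *: ((f \o shift (t, y)) (h *: (1, 0)) - f (t, y))).
Proof.
apply/funext => h /=; congr (_ *: (f _ - _)).
by rewrite [RHS](_ : _ = (h *: 1 + t, h *: 0 + y)) // scaler0 add0r.
Qed.

Lemma derive_time (f : R * U -> W) t y :
  'D_1 (fun t' => f (t', y)) t = 'D_(1, 0) f (t, y).
Proof. by rewrite /derive quotient_time. Qed.

Lemma derivable_time (f : R * U -> W) t y :
  derivable f (t, y) (1, 0) -> derivable (fun t' => f (t', y)) t 1.
Proof. by rewrite /derivable quotient_time. Qed.

End Slices.

Lemma flat_time {R : realType} {U : normedModType R} (O : set (R * U))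
    (f : R * U -> R) y :
  flat O [set q | q.1 = 0] (1, 0) f -> O (0, y) ->
  f (0, y) = 0 /\ is_derive (0 : R) 1 (fun t => f (t, y)) 0.
Proof.
move=> [sf f0] Oy; have [fy dfy] := f0 (0, y) Oy erefl; split=> //.
split; last by rewrite (derive_time f) dfy.
exact/(derivable_time (f := f))/diff_derivable/(smooth_diff sf Oy).
Qed.


Section Bridge.
Context {R : realType} {d : nat}.
Local Notation C := R[i].
Local Notation Q := (R * 'rV[R]_2)%type.
Local Notation e0 := ((0, delta_mx 0 0) : Q).
Local Notation e1 := ((0, delta_mx 0 1) : Q).

Lemma pdC_slice (H : Q -> 'rV[C]_d) e t y :
  pdC e (fun y' => H (t, y')) y = mxder (0, e) H (t, y).
Proof.
apply/rowP => k; rewrite !mxE /cder.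
by rewrite -(derive_slice (fun q => complex.Re (H q 0 k)))
           -(derive_slice (fun q => complex.Im (H q 0 k))).
Qed.

Lemma dz_slice (H : Q -> 'rV[C]_d) t y :
  dz (fun y' => H (t, y')) y = mdz e0 e1 H (t, y).
Proof. by rewrite /dz !pdC_slice. Qed.

(** The derivatives of the maps at fixed times assemble to derivatives on the
    product with the time axis, where smoothness and flatness make sense. *)
Lemma zder_slice (G : 'rV[R]_d -> 'M[R]_d) (x : Q -> 'rV[R]_d) r t y :
  zder G (fun y' => x (t, y')) r y = iter_dz e0 e1 G x r (t, y).
Proof.
elim: r y => [|r IH] y; first exact: (dz_slice (fun q => toC (x q))).
rewrite [LHS]/= (_ : zder G _ r = fun y' => iter_dz e0 e1 G x r (t, y')).
  by rewrite (dz_slice (iter_dz e0 e1 G x r)) (dz_slice (fun q => toC (x q))).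
exact/funext.
Qed.

Lemma dz_open_eq (O : set 'rV[R]_2) (F H : 'rV[R]_2 -> 'rV[C]_d) y :
  open O -> (forall y, O y -> F y = H y) -> O y -> dz F y = dz H y.
Proof.
move=> oO FH Oy.
have pdE e : pdC e F y = pdC e H y.
  apply/rowP => k; rewrite !mxE; congr Complex; apply: near_eq_derive;
  by apply: near_open_eq Oy => // y' Oy'; rewrite FH.
by rewrite /dz !pdE.
Qed.

Lemma zder_open_eq (O : set 'rV[R]_2) (G : 'rV[R]_d -> 'M[R]_d)
    (f f' : 'rV[R]_2 -> 'rV[R]_d) r y :
  open O -> (forall y, O y -> f y = f' y) -> O y -> zder G f r y = zder G f' r y.
Proof.
move=> oO ff'; have dzE z : O z ->
    dz (fun y' => toC (f y')) z = dz (fun y' => toC (f' y')) z.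
  by apply: dz_open_eq => // y' Oy'; rewrite ff'.
elim: r y => [|r IH] y Oy /=; first exact: dzE.
by rewrite (dz_open_eq oO IH Oy) (IH y Oy) (ff' y Oy) (dzE y Oy).
Qed.

End Bridge.

(** * The metric and the complex structures in a chart *)

Section Pointwise.
Context {R : realType} {n : nat} {N : manifold R n.*2} {g : N -> 'M[R]_(n.*2)}.
Hypothesis oN : oriented N.
Hypothesis rg : riemannian_metric g.
Implicit Types (u : chart R N n.*2).

(** An orientation makes the Jacobians of transition maps positive. *)
Lemma frame_change_unit u x : atlas u -> cdom u x -> frame_change x u \in unitmx.
Proof.
move=> au ux; have := oN (chart_at_atlas x) au (chart_at_dom x) ux.
by rewrite unitmxE unitfE => /lt0r_neq0.
Qed.

Lemma metric_unit x : g x \in unitmx.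
Proof.
have [_ pos _] := rg; rewrite -row_free_unit -kermx_eq0; apply/rowV0P => v.
move=> /sub_kermxP vg; apply/eqP; apply/negPn/negP => /(pos x).
by rewrite vg mul0mx mxE ltxx.
Qed.

Lemma metric_in_unit u y : atlas u -> cimg u y -> metric_in g u y \in unitmx.
Proof.
move=> au [x ux <-]; rewrite /metric_in.
have [_ _ cK _ _] := atlas_is_chart au; rewrite cK // /form_in.
have Fu := frame_change_unit au ux.
by rewrite !unitmx_mul unitmx_tr unitmx_inv Fu metric_unit.
Qed.

Lemma endo_crd_square u (s : twistor g) : atlas u -> cdom u (tbase s) ->
  (endo_crd u s).2 *m (endo_crd u s).2 = - 1%:M.
Proof.
move=> au us; have Fu := frame_change_unit au us.
rewrite /= /endo_in !mulmxA mulmxK // -(mulmxA _ (tcs s) (tcs s)) tcs_square.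
by rewrite mulmxN mulmx1 mulNmx mulVmx.
Qed.

Lemma endo_crd_orthogonal u (s : twistor g) : atlas u -> cdom u (tbase s) ->
  let E := endo_crd u s in
  E.2 *m metric_in g u E.1 *m E.2^T = metric_in g u E.1.
Proof.
move=> au us /=; have Fu := frame_change_unit au us.
have [_ _ cK _ _] := atlas_is_chart au.
rewrite /metric_in cK // /form_in /endo_in !trmx_mul trmx_inv !mulmxA.
rewrite mulmxK // mulmxKV ?unitmx_tr //.
by rewrite -(mulmxA _ (tcs s) (g _)) -(mulmxA _ (tcs s *m _)) tcs_orthogonal.
Qed.

End Pointwise.

(** * From dbar to the pairings, in coordinates *)

Section RealToComplex.
Context {R : realType} {V : normedModType R}.
Local Notation C := R[i].
Variables (O S : set V) (tau : V).
Hypothesis oO : open O.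

Lemma toCM {m n p} (A : 'M[R]_(m, n)) (B : 'M[R]_(n, p)) :
  toC (A *m B) = toC A *m toC B.
Proof. exact: map_mxM. Qed.

Lemma toCD {m n} (A B : 'M[R]_(m, n)) : toC (A + B) = toC A + toC B.
Proof. exact: map_mxD. Qed.

Lemma toCB {m n} (A B : 'M[R]_(m, n)) : toC (A - B) = toC A - toC B.
Proof. exact: map_mxB. Qed.

Lemma mxder_real {m n} (M : V -> 'M[R]_(m, n)) e q : differentiable M q ->
  mxder e (fun y => toC (M y)) q = toC ('D_e M q).
Proof.
move=> dM; apply/matrixP => i j.
rewrite !mxE (derive_mx (@diff_derivable _ _ _ M q e dM)).
rewrite mxE /cder; congr Complex.
  by congr ('D_e _ q); apply/funext => y; rewrite mxE.
by rewrite -[RHS](derive_cst (0 : R) q e); congr ('D_e _ q); apply/funext => y;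
   rewrite mxE.
Qed.

Lemma mxsmooth_real {m n} (M : V -> 'M[R]_(m, n)) :
  (forall i j, smooth_on O (fun q => M q i j)) -> mxsmooth O (fun q => toC (M q)).
Proof.
move=> sM i j; apply: (csmooth_eq oO _ (csmooth_real oO (sM i j))) => q _.
by rewrite mxE.
Qed.

Lemma mxflat_real {m n} (Z : V -> 'M[C]_(m, n)) (M : V -> 'M[R]_(m, n)) :
  mxsmooth O Z -> (forall q, O q -> Z q = toC (M q)) ->
  (forall q, O q -> S q ->
    M q = 0 /\ forall i j, 'D_tau (fun y => M y i j) q = 0) ->
  mxflat O S tau Z.
Proof.
move=> sZ ZM M0 i j; have [s1 s2] := sZ i j; split; split => // q Oq Sq.
  have [Mq dM] := M0 q Oq Sq; rewrite ZM // Mq mxE mxE; split=> //.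
  rewrite -[RHS](dM i j); apply: near_eq_derive.
  by apply: near_open_eq Oq => // y Oy; rewrite ZM // mxE.
rewrite ZM // mxE; split=> //.
rewrite -[RHS](derive_cst (0 : R) q tau); apply: near_eq_derive.
by apply: near_open_eq Oq => // y Oy; rewrite ZM // mxE.
Qed.

Section Connection.
Context {d : nat} (U : set 'rV[R]_d) (G : 'rV[R]_d -> 'M[R]_d).
Variable x : V -> 'rV[R]_d.
Hypothesis oU : open U.
Hypothesis sG : smooth_on U G.
Hypothesis uG : forall y, U y -> G y \in unitmx.
Hypothesis sx : smooth_on O x.
Hypothesis Ux : forall q, O q -> U (x q).

Let chr k i j : csmooth O (fun q => (christoffel G (x q) k i j)%:C%C).
Proof.
apply: (csmooth_real oO).
apply: (smooth_comp oO Ux sx (h := fun y => christoffel G y k i j)).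
exact: smooth_christoffel.
Qed.

Lemma mxsmooth_conn v :
  mxsmooth O v -> mxsmooth O (fun q => connC G (x q) (v q)).
Proof.
move=> sv j k; have := csmooth_sum oO (index_enum 'I_d)
  (fun i => csmoothM oO (sv 0 i) (chr k i j)).
by apply: csmooth_eq => // q _; rewrite mxE.
Qed.

Lemma mxflat_conn v :
  mxflat O S tau v -> mxflat O S tau (fun q => connC G (x q) (v q)).
Proof.
move=> fv j k; have := cflat_sum oO (index_enum 'I_d)
  (fun i => cflatM oO (fv 0 i) (chr k i j)).
by apply: cflat_eq => // q _; rewrite mxE.
Qed.

Lemma mxsmooth_metric : mxsmooth O (fun q => toC (G (x q))).
Proof.
apply: mxsmooth_real => i j; apply: (smooth_comp oO Ux sx (h := fun y => G y i j)).
exact: smooth_entry.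
Qed.

End Connection.

Lemma connC_real {d} (G : 'rV[R]_d -> 'M[R]_d) x v :
  connC G x (toC v) = toC (conn G x v).
Proof.
apply/matrixP => j k; rewrite !mxE rmorph_sum.
by apply: eq_bigr => i _; rewrite (rmorphM _ (v 0 i)) mxE.
Qed.

Lemma connB {d} (G : 'rV[R]_d -> 'M[R]_d) x v w :
  conn G x (v - w) = conn G x v - conn G x w.
Proof.
apply/matrixP => j k; rewrite !mxE -sumrB.
by apply: eq_bigr => i _; rewrite !mxE mulrBl.
Qed.

Lemma vert_dbar_alg {d} (A D v0 c1 c0 : 'M[R]_d) :
  D + A *m c1 - c1 *m A - v0 - (A *m (c1 - c0) - (c1 - c0) *m A) =
  D - (c0 *m A - A *m c0 + v0).
Proof.
rewrite mulmxBr mulmxBl.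
move: (A *m c1) (A *m c0) (c1 *m A) (c0 *m A) => *.
by apply/matrixP => i j; rewrite !mxE; ring.
Qed.

End RealToComplex.

Section Core.
Context {R : realType} {d : nat}.
Local Notation endo := ('rV[R]_d * 'M[R]_d)%type.
Local Notation Q := (R * 'rV[R]_2)%type.
Local Notation e0 := ((0, delta_mx 0 0) : Q).
Local Notation e1 := ((0, delta_mx 0 1) : Q).
Local Notation tau := ((1, 0) : Q).
Local Notation S := [set q : Q | q.1 = 0].
Variables (O : set Q) (U : set 'rV[R]_d) (G : 'rV[R]_d -> 'M[R]_d) (F : Q -> endo).
Hypothesis oO : open O.
Hypothesis oU : open U.
Hypothesis sG : smooth_on U G.
Hypothesis uG : forall y, U y -> G y \in unitmx.
Hypothesis sF : smooth_on O F.
Hypothesis UF : forall q, O q -> U (F q).1.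
Hypothesis FF : forall q, O q -> (F q).2 *m (F q).2 = - 1%:M.
Hypothesis FG : forall q, O q ->
  (F q).2 *m G (F q).1 *m (F q).2^T = G (F q).1.

(** [dbar] of the first coordinate vector of the surface, in terms of F. *)
Definition dbarF q : endo := 'D_e1 F q - acs1 G (F q) ('D_e0 F q).

Hypothesis hF : forall y, O (0, y) ->
  dbarF (0, y) = 0 /\ is_derive (0 : R) 1 (fun t => dbarF (t, y)) 0.

Local Notation x := (fun q => (F q).1).
Local Notation A := (fun q => toC (F q).2).

Let cfst : continuous (@fst 'rV[R]_d 'M[R]_d).
Proof. by move=> q; apply: cvg_fst. Qed.
Let csnd : continuous (@snd 'rV[R]_d 'M[R]_d).
Proof. by move=> q; apply: cvg_snd. Qed.

Let sx : smooth_on O x. Proof. exact: (smooth_linear oO cfst sF). Qed.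
Let sA' : smooth_on O (fun q => (F q).2).
Proof. exact: (smooth_linear oO csnd sF). Qed.
Let sX : mxsmooth O (fun q => toC (x q)).
Proof. by apply: (mxsmooth_real oO) => i j; apply: smooth_entry. Qed.
Let sA : mxsmooth O A.
Proof. by apply: (mxsmooth_real oO) => i j; apply: smooth_entry. Qed.

Let dX e q : O q -> mxder e (fun q => toC (x q)) q = toC ('D_e F q).1.
Proof.
move=> Oq; rewrite mxder_real; last exact: smooth_diff sx Oq.
by rewrite (derive_linear e cfst) //; apply: smooth_diff sF Oq.
Qed.

Let dA e q : O q -> mxder e A q = toC ('D_e F q).2.
Proof.
move=> Oq; rewrite mxder_real; last exact: smooth_diff sA' Oq.
by rewrite (derive_linear e csnd) //; apply: smooth_diff sF Oq.
Qed.

Let nabAE e q : O q -> nabA G x A e q = toC (vert G (F q) ('D_e F q)).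
Proof.
move=> Oq; rewrite /nabA /vert (dX e Oq) (dA e Oq) connC_real.
by rewrite toCB toCD !toCM.
Qed.

Let derive_dbarF {m k} (L : {linear endo -> 'M[R]_(m, k)}) y i j :
  continuous L -> O (0, y) ->
  'D_tau (fun q => L (dbarF q) i j) (0, y) = 0.
Proof.
move=> cL Oy; have [_ [D0 E0]] := hF Oy.
have df : differentiable (fun t => dbarF (t, y)) 0 by apply/derivable1_diffP.
have dLf : differentiable (fun t => L (dbarF (t, y))) 0.
  by apply: differentiable_comp => //; apply: linear_differentiable.
rewrite -(derive_time (fun q => L (dbarF q) i j)).
have := @derive_linear R R _ _ _ _ 0 1 cL df; rewrite E0 linear0 => e.
have := derive_mx (@diff_derivable R R _ _ 0 1 dLf); rewrite e => /matrixP/(_ i j).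
by rewrite !mxE.
Qed.

Let sconn := mxsmooth_conn oO oU sG uG sx UF.

Let dbar_ptE q : O q -> dbar_pt e0 e1 x A q = toC (dbarF q).1.
Proof.
move=> Oq; rewrite /dbar_pt (dX e0 Oq) (dX e1 Oq) -toCM -toCB.
by rewrite /dbarF /acs1 /= addr0.
Qed.

Let sdbar_pt : mxsmooth O (dbar_pt e0 e1 x A).
Proof.
have sdX e := mxsmooth_der oO e sX.
exact: (mxsmoothB oO (sdX e1) (mxsmoothM oO (sdX e0) sA)).
Qed.

Let fdbar_pt : mxflat O S tau (dbar_pt e0 e1 x A).
Proof.
apply: (mxflat_real oO sdbar_pt dbar_ptE) => -[t y] Oq /= t0; rewrite t0 in Oq *.
have [e _] := hF Oq; split=> [|i j]; last exact: (derive_dbarF i j cfst).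
exact: (congr1 fst e).
Qed.

(** The term coming from lifting x_0 A instead of x_1 horizontally. *)
Let corr q := A q *m connC G (x q) (dbar_pt e0 e1 x A q)
  - connC G (x q) (dbar_pt e0 e1 x A q) *m A q.

Let dbar_csE q : O q -> dbar_cs e0 e1 G x A q - corr q = toC (dbarF q).2.
Proof.
move=> Oq; rewrite /corr /dbar_cs (nabAE e0 Oq) (nabAE e1 Oq) (dbar_ptE Oq).
rewrite connC_real.
rewrite -!toCM -!toCB; congr toC.
have -> : (dbarF q).1 = ('D_e1 F q).1 - ('D_e0 F q).1 *m (F q).2.
  by rewrite /dbarF /acs1 /= addr0.
have -> : (dbarF q).2 = ('D_e1 F q).2
    - (conn G (x q) (('D_e0 F q).1 *m (F q).2) *m (F q).2
       - (F q).2 *m conn G (x q) (('D_e0 F q).1 *m (F q).2)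
       + vert G (F q) ('D_e0 F q) *m (F q).2) by [].
rewrite connB {1}/vert.
exact: (vert_dbar_alg (F q).2 ('D_e1 F q).2 (vert G (F q) ('D_e0 F q) *m (F q).2)
  (conn G (F q).1 ('D_e1 F q).1) (conn G (F q).1 (('D_e0 F q).1 *m (F q).2))).
Qed.

Let fdbar_cs : mxflat O S tau (dbar_cs e0 e1 G x A).
Proof.
have scE := sconn sdbar_pt.
have sc : mxsmooth O corr.
  exact: (mxsmoothB oO (mxsmoothM oO sA scE) (mxsmoothM oO scE sA)).
have fcE := mxflat_conn oO oU sG uG sx UF fdbar_pt.
have fc : mxflat O S tau corr.
  exact: (mxflatB oO (mxflatMl oO sA fcE) (mxflatMr oO fcE sA)).
have sdbar_cs : mxsmooth O (dbar_cs e0 e1 G x A).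
  have sn e := mxsmooth_nabA oO sX sA sconn e.
  exact: (mxsmoothB oO (sn e1) (mxsmoothM oO (sn e0) sA)).
have fZ : mxflat O S tau (fun q => dbar_cs e0 e1 G x A q - corr q).
  apply: (mxflat_real oO (mxsmoothB oO sdbar_cs sc) dbar_csE) => -[t y] Oq /= t0.
  rewrite t0 in Oq *.
  have [e _] := hF Oq; split=> [|i j]; last exact: (derive_dbarF i j csnd).
  exact: (congr1 snd e).
apply: (mxflat_eq oO _ (mxflatD oO fZ fc)) => q _.
exact: subrK.
Qed.

Lemma mxflat_zpairing r s : mxflat O S tau (fun q =>
  iter_dz e0 e1 G x r q *m toC (G (x q)) *m (iter_dz e0 e1 G x s q)^T).
Proof.
have Se e q (h : R) : S q -> S (h *: ((0, e) : Q) + q).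
  by move: q => [t y] /= ->; rewrite scaler0 addr0.
have AA q : O q -> A q *m A q = - 1%:M.
  move=> Oq; rewrite -toCM FF //; apply/matrixP => i j.
  by rewrite !mxE rmorphN rmorph_nat.
have AG q : O q -> A q *m toC (G (x q)) *m (A q)^T = toC (G (x q)).
  move=> Oq; have -> : (A q)^T = toC (F q).2^T.
    by apply/matrixP => i j; rewrite !mxE.
  by rewrite -!toCM FG.
have sGx := mxsmooth_metric oO oU sG sx UF.
exact: (mxflat_pairing oO (Se _) (Se _) sX sA sGx sconn AA AG fdbar_pt
  fdbar_cs r s).
Qed.

End Core.

Lemma near_slice {R : realType} {U : normedModType R} (O : set (R * U)) t y :
  open O -> O (t, y) ->
  (\forall y' \near y, O (t, y')) /\ (\forall t' \near t, O (t', y)).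
Proof.
move=> oO Oty; have [[A B] /= [nA nB] AB] := open_nbhs_nbhs (conj oO Oty).
split; [apply: filterS nB => y' By|apply: filterS nA => t' At];
  by apply: AB; split => //=; apply: nbhs_singleton.
Qed.

(** * Conclusion *)

Theorem propositionV2p14 (R : realType) (n : nat)
    (N : manifold R n.*2) (g : N -> 'M[R]_(n.*2))
    (M : manifold R 2) (I : set R) (psi : R -> M -> twistor g) :
  @second_countable N -> oriented N -> riemannian_metric g ->
  riemann_surface M ->
  is_interval I -> nbhs (0 : R) I ->
  smooth_variation I psi ->
  holomorphic_first_order psi ->
  isotropic_first_order g (fun t x => tbase (psi t x)).
Proof.
move=> _ oN rg _ _ I0 sv hol p z u r s az zp au up /=.
have [W [F [oW Wp sFW FEW]]] := sv 0 p z u (nbhs_singleton I0) az zp au up.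
have [_ oU _ _ _] := atlas_is_chart au.
have [_ _ zK _ _] := atlas_is_chart az.
have [_ _ /(_ u au) sG] := rg.
pose G := metric_in g u; pose e0 : 'rV[R]_2 := delta_mx 0 0.
(* On the interior of I the map F is an actual family of twistors. *)
pose O := W `&` (fst @^-1` I°).
have oO : open O.
  apply: openI => //; apply: open_comp; last exact: open_interior.
  by move=> q _; apply: cvg_fst.
have sF : smooth_on O F by move=> vs q [Oq _]; apply: sFW.
have FE t y : O (t, y) -> [/\ cimg z y, cdom u (tbase (psi t (cpt z y))) &
    endo_crd u (psi t (cpt z y)) = F (t, y)].
  by move=> [Oq It]; apply: FEW => //; apply: (@interior_subset _ I).
have UF q : O q -> cimg u (F q).1.
  by case: q => t y /FE[_ ut <-]; exists (tbase (psi t (cpt z y))).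
have FF q : O q -> (F q).2 *m (F q).2 = - 1%:M.
  by case: q => t y /FE[_ ut <-]; apply: endo_crd_square.
have FG q : O q -> (F q).2 *m G (F q).1 *m (F q).2^T = G (F q).1.
  by case: q => t y /FE[_ ut <-]; apply: endo_crd_orthogonal.
have uG y : cimg u y -> G y \in unitmx by apply: metric_in_unit.
have dpsiE t y v : O (t, y) ->
    dpsi psi u z (cpt z y) v t = 'D_(0, v) F (t, y).
  move=> Oty; have [[p' zp' pE] _ _] := FE _ _ Oty; rewrite /dpsi.
  have -> : crd z (cpt z y) = y by rewrite -pE zK.
  rewrite -derive_slice; apply: near_eq_derive.
  by apply: filterS (near_slice oO Oty).1 => y' /FE[].
have dbarE t y : O (t, y) -> dbar psi u z (cpt z y) e0 t = dbarF G F (t, y).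
  move=> Oty; have [_ _ E] := FE _ _ Oty.
  have eJ : e0 *m J0 R = delta_mx 0 1.
    by rewrite /e0 /J0 mulmxBr !mul_delta_mx_cond /= subr0.
  by rewrite /dbar (dpsiE t y _ Oty) (dpsiE t y _ Oty) E eJ.
have hF y : O (0, y) ->
    dbarF G F (0, y) = 0 /\ is_derive (0 : R) 1 (fun t => dbarF G F (t, y)) 0.
  move=> Oy; have [[p' zp' pE] u0 _] := FE _ _ Oy.
  have zp0 : cdom z (cpt z y) by rewrite -pE zK.
  have [V0 par] := hol _ _ _ e0 az zp0 au u0.
  split; first by rewrite -dbarE.
  apply: near_eq_is_derive (covderiv0_vanishes_derive u0 V0 par).
  by apply: filterS (near_slice oO Oy).2 => t; apply: dbarE.
have Op : O (0, crd z p) by split=> //=; apply: nbhs_interior.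
pose x (q : R * 'rV[R]_2) := (F q).1.
pose W_ k := iter_dz (0, e0) (0, delta_mx 0 1) G x k.
pose P q := (W_ r q *m toC (G (x q)) *m (W_ s q)^T) 0 0.
have [fRe fIm] : cflat O [set q | q.1 = 0] (1, 0) P.
  exact: (mxflat_zpairing oO oU sG uG sF UF FF FG hF r s 0 0).
have hE t : O (t, crd z p) ->
    zpairing G (fun y => crd u (tbase (psi t (cpt z y)))) r s (crd z p) =
    P (t, crd z p).
  move=> Oty; pose D := [set y | O (t, y)]°.
  have Dp : D (crd z p) := (near_slice oO Oty).1.
  have fE y : D y -> crd u (tbase (psi t (cpt z y))) = x (t, y).
    by move=> /interior_subset/FE[_ _ E]; rewrite /x -E.
  have zE k : zder G (fun y => crd u (tbase (psi t (cpt z y)))) k (crd z p) =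
      W_ k (t, crd z p).
    by rewrite (zder_open_eq G k (@open_interior _ _) fE Dp) zder_slice.
  by rewrite /zpairing (zE r) (zE s) (fE _ Dp).
have near_hE : \forall t \near (0 : R), P (t, crd z p) =
    zpairing G (fun y => crd u (tbase (psi t (cpt z y)))) r s (crd z p).
  by apply: filterS (near_slice oO Op).2 => t /hE.
have [Re0 dRe] := flat_time fRe Op; have [Im0 dIm] := flat_time fIm Op.
split.
- rewrite (hE 0 Op); case: (P (0, crd z p)) Re0 Im0 => a b /= -> ->.
  by [].
- by apply: near_eq_is_derive dRe; apply: filterS near_hE => t ->.
- by apply: near_eq_is_derive dIm; apply: filterS near_hE => t ->.
Qed.
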